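(* Let $H\in(0,1)$, $\tau\ge0$, $\sigma\in\mathbb{R}$, $\lambda<\lambda^*$, and let $(x_t)_{t\ge0}$ be a solution of the scalar equation $$\mathrm{d}x_t=A(\lambda)\,x_t\,\mathrm{d}t+\sigma\,\mathrm{d}W^H_t .$$ Then the time-asymptotic autocovariance $V_\infty(\tau)=\lim_{t\to\infty}V_t(\tau)$ is $$V_\infty(\tau)=\frac{\sigma^2}{2}H|A(\lambda)|^{-2H}\left(e^{A(\lambda)\tau}\Gamma(2H)+e^{-A(\lambda)\tau}\Gamma(2H,|A(\lambda)|\tau)-e^{A(\lambda)\tau}\int_0^{|A(\lambda)|\tau}e^{w}w^{2H-1}\,\mathrm{d}w\right).$$
   Context: $A:(-\infty,\lambda^*]\to\mathbb{R}$ is continuous with $A(\lambda)<0$ for $\lambda<\lambda^*$ and $A(\lambda^* )=0$. $(W^H_t)_{t\ge0}$ is a scalar fractional Brownian motion with Hurst index $H$: a centered Gaussian process with $\mathbb{E}[W^H_tW^H_s]=\tfrac12(t^{2H}+s^{2H}-|t-s|^{2H})$. Solutions satisfy $x_t=x_0+A(\lambda)\int_0^tx_s\,\mathrm{d}s+\sigma W^H_t$, with deterministic initial condition $x_0\in\mathbb{R}$. The autocovariance is $V_t(\tau)=\mathbb{E}[x_tx_{t+\tau}]-\mathbb{E}[x_t]\mathbb{E}[x_{t+\tau}]$. For $s>0$, $\Gamma(s)=\int_0^\infty w^{s-1}e^{-w}\,\mathrm{d}w$ and $\Gamma(s,z)=\int_z^\infty w^{s-1}e^{-w}\,\mathrm{d}w$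 for $z\ge0$. *)

(* Defs.v *)
From HB Require Import structures.
From mathcomp Require Import all_boot all_order all_algebra.
From mathcomp Require Import all_classical all_reals all_analysis.

Set Implicit Arguments.
Unset Strict Implicit.
Unset Printing Implicit Defensive.

Import Order.TTheory GRing.Theory Num.Theory.
Import numFieldNormedType.Exports.

Local Open Scope classical_set_scope.
Local Open Scope ring_scope.

(* Degenerate laws are allowed and handled by [dirac]: for [s = 0],
   [normal_prob m s] is the uniform law on [0, 1]. *)
Definition gaussian_variable {d : measure_display} {T : measurableType d}
    {R : realType} (P : probability T R) (X : {RV P >-> R}) : Prop :=
  (exists m s : R, s != 0 /\
     forall B : set R, measurable B -> distribution P X B = normal_prob m s B)
  \/ (exists m : R,
     forall B : set R, measurable B -> distribution P X B = \d_m B).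

(* Processes are families indexed by all of [R]; only the times [t >= 0] are
   ever constrained or used. *)
Definition gaussian_process {d : measure_display} {T : measurableType d}
    {R : realType} (P : probability T R) (X : R -> {RV P >-> R}) : Prop :=
  forall (n : nat) (t c : 'I_n -> R), (forall i, 0 <= t i) ->
    exists Y : {RV P >-> R},
      (forall w, Y w = \sum_(i < n) c i * X (t i) w) /\ gaussian_variable Y.

Definition fractional_brownian_motion {d : measure_display}
    {T : measurableType d} {R : realType} (P : probability T R) (H : R)
    (W : R -> {RV P >-> R}) : Prop :=
  [/\ gaussian_process W,
      (forall t : R, 0 <= t -> ('E_P[W t] = 0)%E) &
      (forall t s : R, 0 <= t -> 0 <= s ->
         'E_P[W t \* W s]%E =
         (2^-1 * (t `^ (2 * H) + s `^ (2 * H) - `|t - s| `^ (2 * H)))%:E)].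

(* [dx_t = a x_t dt + sigma dW_t] with deterministic initial value [x0].
   The continuity of the paths makes the pathwise integral meaningful. *)
Definition langevin_solution {d : measure_display} {T : measurableType d}
    {R : realType} (P : probability T R) (a sigma x0 : R)
    (W x : R -> {RV P >-> R}) : Prop :=
  {ae P, forall w : T,
     {within `[0, +oo[, continuous (fun t : R => x t w)} /\
     forall t : R, 0 <= t ->
       x t w = x0 + a * (\int[lebesgue_measure]_(s in `[0, t]) x s w)
               + sigma * W t w}.

Definition autocovariance {d : measure_display} {T : measurableType d}
    {R : realType} (P : probability T R) (x : R -> {RV P >-> R}) (tau t : R)
    : \bar R :=
  ('E_P[x t \* x (t + tau)%R] - 'E_P[x t] * 'E_P[x (t + tau)%R])%E.

Definition Gamma {R : realType} (s : R) : R :=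
  \int[lebesgue_measure]_(w in `[0, +oo[) (w `^ (s - 1) * expR (- w)).

Definition upper_Gamma {R : realType} (s z : R) : R :=
  \int[lebesgue_measure]_(w in `[z, +oo[) (w `^ (s - 1) * expR (- w)).

(* Main.v *)
Require Import Defs.
From mathcomp Require Import all_boot all_order all_algebra.
From mathcomp Require Import all_classical all_reals all_analysis.
From mathcomp Require Import measurable_realfun.
From mathcomp Require Import ring lra.
Import Order.TTheory GRing.Theory Num.Theory.
Import numFieldNormedType.Exports.
Local Open Scope classical_set_scope.
Local Open Scope ring_scope.

(** Put [th = - A lambda > 0] and [h = 2 * H].

    The equation is linear and the noise [Z = sigma * W] has continuous paths,
    so variation of constants ([variation_of_constants]) gives, on almost every
    path, [x_t = e^(- th t) x_0 + Y_t] with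
    [Y_t = Z_t - th * int_0^t e^(th (s - t)) Z_s ds].  The first term is
    deterministic: the autocovariance of [x] is that of the centered process
    [Y].  Fubini's theorem ([fubini_path_integral], which rests on the joint
    measurability of a process with continuous paths) turns the covariance of
    [Y] into an iterated integral of the covariance of fractional Brownian
    motion ([centered_solution_cov]).

    That integral has a closed form.  Write [phi r = |r|^h] and let [p] be the
    solution of [p' = - th p + phi] that does not grow exponentially at minus
    infinity, that is [p r = int_(-oo)^r e^(- th (r - v)) phi v dv]; its
    reflection [q r = p (- r)] solves [q' = th q - phi].  These two equations
    give explicit antiderivatives of all the integrands involved, and with
    [C = (th / 2 (p + q) - phi) / 2] one finds ([transient_cov])
    [Cov(Y_t, Y_t') / sigma^2 = C (t' - t) - e^(- th t) C t' - e^(- th t') C t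
    + e^(- th (t + t')) C 0].
    This is the covariance of [X_t - e^(- th t) X_0], where [X] is the
    stationary solution and [C] its covariance function for [sigma = 1].  As
    [e^(- th t) C t] tends to [0], the limit is [sigma^2 * C tau]
    ([cvg_transient_cov]).

    It remains to recognise [C].  Integrating by parts once, from the weight
    [w^h] to the weight [h w^(h - 1)], turns [p tau] and [q tau] into the complete
    and incomplete Gamma integrals of the statement; the powers [tau^h] so
    produced cancel against [phi tau] ([stationary_covE]). *)

Set Implicit Arguments.
Unset Strict Implicit.
Unset Printing Implicit Defensive.

(** * Derivatives and primitives on the real line *)

Section Calculus.
Context {R : realType}.
Implicit Types (f g F G : R -> R) (x y a b u k : R).
Local Notation mu := (@lebesgue_measure R).

Lemma is_derive_mulfun f g x a b : is_derive x 1 f a -> is_derive x 1 g b ->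
  is_derive x 1 (fun s => f s * g s) (a * g x + f x * b).
Proof.
move=> df dg; have := is_deriveM df dg; move/is_derive_eq; apply.
by rewrite /GRing.scale /= addrC mulrC.
Qed.

Lemma is_derive_addfun f g x a b : is_derive x 1 f a -> is_derive x 1 g b ->
  is_derive x 1 (fun s => f s + g s) (a + b).
Proof. exact: is_deriveD. Qed.

Lemma is_derive_scalefun f x a k : is_derive x 1 f a ->
  is_derive x 1 (fun s => k * f s) (k * a).
Proof. exact: is_deriveZ. Qed.

Lemma is_derive_linear k x : is_derive x 1 (fun s => k * s) k.
Proof.
have := @is_derive_scalefun id x 1 k (is_derive_id _ _).
by rewrite mulr1.
Qed.

Lemma is_derive_compfun f g x a b : is_derive (g x) 1 f a ->
  is_derive x 1 g b -> is_derive x 1 (fun s => f (g s)) (a * b).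
Proof. exact: is_derive1_comp. Qed.

Lemma is_derive_expRM k x :
  is_derive x 1 (fun s => expR (k * s)) (k * expR (k * x)).
Proof.
rewrite [k * expR _]mulrC; apply: (@is_derive_compfun expR (fun s => k * s)).
exact: is_derive_linear.
Qed.

Lemma is_derive_scalearg f k x a : is_derive (k * x) 1 f a ->
  is_derive x 1 (fun s => f (k * s)) (k * a).
Proof.
move=> df; rewrite mulrC; apply: (@is_derive_compfun f (fun s => k * s)) => //.
exact: is_derive_linear.
Qed.

Lemma is_derive_subarg f u x a : is_derive (x - u) 1 f a ->
  is_derive x 1 (fun s => f (s - u)) a.
Proof.
move=> df; rewrite -[a]mulr1.
apply: (@is_derive_compfun f (fun s => s - u)) => //.
exact: is_derive_shift.
Qed.

Lemma is_derive_reflarg f u x a : is_derive (u - x) 1 f a ->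
  is_derive x 1 (fun s => f (u - s)) (- a).
Proof.
move=> df; rewrite -mulrN1.
apply: (@is_derive_compfun f (fun s => u - s)) => //.
have := is_deriveB (is_derive_cst u x (1:R)) (is_derive_id x (1:R)).
by rewrite sub0r.
Qed.

Lemma is_derive_continuous f x a : is_derive x 1 f a -> {for x, continuous f}.
Proof.
by move=> df; apply/differentiable_continuous/derivable1_diffP; exact: ex_derive.
Qed.

Lemma continuous_itv_integrable f a b : continuous f ->
  mu.-integrable `[a, b] (EFin \o f).
Proof.
move=> cf; apply: continuous_compact_integrable; first exact: segment_compact.
exact: continuous_subspaceT.
Qed.

Lemma integral_derive_in f F a b : a < b ->
  (forall x, a <= x <= b -> {for x, continuous f}) ->
  (forall x, a <= x <= b -> is_derive x 1 F (f x)) ->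
  (\int[mu]_(x in `[a, b]) (f x)%:E = (F b - F a)%:E)%E.
Proof.
move=> ab cf dF; rewrite (@continuous_FTC2 _ f F)//.
- apply: continuous_in_subspaceT => x.
  by rewrite inE/= in_itv/=; exact: cf.
- split.
  + move=> x /=; rewrite in_itv/= => /andP[ax xb].
    by apply: ex_derive; apply: dF; rewrite !ltW.
  + apply/cvg_at_right_filter/is_derive_continuous/dF.
    by rewrite lexx ltW.
  + apply/cvg_at_left_filter/is_derive_continuous/dF.
    by rewrite lexx ltW.
- move=> x; rewrite in_itv/= => /andP[ax xb]; rewrite derive1E.
  by apply: derive_val; apply: dF; rewrite !ltW.
Qed.

Lemma Rintegral_derive f F a b : a <= b -> continuous f ->
  (forall x, a <= x <= b -> is_derive x 1 F (f x)) ->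
  \int[mu]_(x in `[a, b]) f x = F b - F a.
Proof.
rewrite le_eqVlt => /predU1P[<- _ _|ab cf dF].
  by rewrite set_itv1 Rintegral_set1 subrr.
by rewrite /Rintegral (integral_derive_in ab (fun x _ => cf x) dF).
Qed.

Lemma is_derive_integral f a x : continuous f -> a < x ->
  is_derive x 1 (fun y => \int[mu]_(t in `[a, y]) f t) (f x).
Proof.
move=> cf ax.
have [d de] := @continuous_FTC1_closed _ f a x (x + 1)
  (ltac:(by rewrite ltrDl)) (continuous_itv_integrable _ _ cf) ax (cf x).
by apply: DeriveDef; [exact: d|rewrite -derive1E; exact: de].
Qed.

(** The oriented integral from [0] to [x]; an integral over a set has no
    orientation, hence the two cases. *)
Definition primitive f x : R :=
  if 0 <= x then \int[mu]_(t in `[0, x]) f t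
  else - \int[mu]_(t in `[x, 0]) f t.

Lemma primitive0 f : primitive f 0 = 0.
Proof. by rewrite /primitive lexx set_itv1 Rintegral_set1. Qed.

Lemma Rintegral_chasles f a b c : continuous f -> a <= b -> b <= c ->
  \int[mu]_(t in `[a, c]) f t =
  \int[mu]_(t in `[a, b]) f t + \int[mu]_(t in `[b, c]) f t.
Proof.
move=> cf ab bc.
have -> : \int[mu]_(t in `[b, c]) f t = \int[mu]_(t in `]b, c]) f t.
  rewrite Rintegral_itv_obnd_cbnd//.
  apply: integrableS (continuous_itv_integrable b c cf) => //.
  exact: subset_itv_oc_cc.
rewrite -(@Rintegral_itvB _ f (BLeft a) (BRight c) b); last 3 first.
- exact: continuous_itv_integrable.
- by rewrite bnd_simp.
- by rewrite bnd_simp.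
by rewrite addrC subrK.
Qed.

(** Near a given point the oriented integral differs by a constant from the
    integral over [[- M, y]] with [M] large, so that no case distinction is
    needed at the origin. *)
Lemma is_derive_primitive f x : continuous f ->
  is_derive x 1 (primitive f) (f x).
Proof.
move=> cf; pose M : R := `|x| + 1.
have xM : - M < x < M by rewrite -ltr_norml /M ltrDl.
have M0 : 0 <= M by rewrite addr_ge0.
have primE y : - M <= y ->
    \int[mu]_(t in `[- M, y]) f t - \int[mu]_(t in `[- M, 0]) f t
    = primitive f y.
  move=> My; rewrite /primitive; case: leP => y0.
    rewrite (@Rintegral_chasles f (- M) 0 y)// ?oppr_le0//.
    ring.
  rewrite (@Rintegral_chasles f (- M) y 0)// ?oppr_le0//; last exact: ltW.
  ring.
have [xM1 _] := andP xM.
have d : is_derive x 1 (fun y => \int[mu]_(t in `[- M, y]) f t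
    + (- \int[mu]_(t in `[- M, 0]) f t)) (f x).
  rewrite -[f x]addr0; apply: is_derive_addfun.
  exact: is_derive_integral.
apply: near_eq_is_derive d.
near=> y; apply: primE; apply: ltW.
by near: y; exact: lt_nbhsr.
Unshelve. all: by end_near. Qed.

End Calculus.
(** * The fundamental theorem of calculus with an integrable singularity *)

Section SingularFTC.
Context {R : realType}.
Implicit Types (f g F G : R -> R) (x y a b u k : R).
Local Notation mu := (@lebesgue_measure R).

(** The derivative [f] may blow up at [a], as [w^(h - 1)] does at [0] for
    [h < 1].  Being nonnegative, [f] has an integral over [[a, b]] that is the
    monotone limit of its integrals over [[c_n, b]] with [c_n] decreasing to
    [a], and [F] is continuous at [a]. *)
Lemma ge0_singular_FTC2 f F a b : a < b -> measurable_fun setT f ->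
  (forall x, a < x <= b -> 0 <= f x) ->
  (forall x, a < x <= b -> {for x, continuous f}) ->
  (forall x, a < x <= b -> is_derive x 1 F (f x)) ->
  F x @[x --> a^'+] --> F a ->
  (\int[mu]_(x in `[a, b]) (f x)%:E = (F b - F a)%:E)%E.
Proof.
move=> ab mf f0 cf dF Fa.
have mfab (D : set R) : measurable_fun D (fun x => (f x)%:E).
  by apply/measurable_EFinP; exact: measurable_funTS.
rewrite -integral_itv_obnd_cbnd//.
pose c n : R := a + (b - a) / n.+2%:R.
have ac n : a < c n.
  by rewrite ltrDl divr_gt0// subr_gt0.
have cb n : c n < b.
  rewrite /c -ltrBrDl ltr_pdivrMr// ltr_pMr ?subr_gt0//.
  by rewrite ltr1n.
have cvgc : c n @[n --> \oo] --> a.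
  rewrite -[X in _ --> X]addr0; apply: cvgD; first exact: cvg_cst.
  rewrite -[X in _ --> X](mulr0 (b - a)); apply: cvgM; first exact: cvg_cst.
  have h := @cvg_harmonic R; rewrite -cvg_shiftS in h; exact: h.
pose g n : R -> \bar R := (EFin \o f) \_ `[c n, b].
have gE n : (\int[mu]_(x in `]a, b]) g n x = (F b - F (c n))%:E)%E.
  rewrite -integral_mkcondr setIidr; last first.
    by apply: subset_itvr; rewrite bnd_simp.
  apply: integral_derive_in => // x /andP[cx xb].
    by apply: cf; rewrite (lt_le_trans (ac n) cx).
  by apply: dF; rewrite (lt_le_trans (ac n) cx).
have lim1 : (\int[mu]_(x in `]a, b]) g n x)%E @[n --> \oo] -->
    (\int[mu]_(x in `]a, b]) (f x)%:E)%E.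
  have -> : (\int[mu]_(x in `]a, b]) (f x)%:E =
      \int[mu]_(x in `]a, b]) limn (g^~ x))%E.
    apply: eq_integral => x; rewrite inE/= in_itv/= => /andP[ax xb].
    have cx : \forall n \near \oo, c n < x by exact: cvgr_lt cvgc _ ax.
    apply/esym/cvg_lim => //; apply: cvg_near_cst; near=> m.
    by rewrite /g patchE ifT// inE/= in_itv/= xb andbT ltW//; near: m.
  apply: cvg_monotone_convergence => //.
  - move=> k; apply: measurable_funTS.
    by apply/(measurable_restrictT _ _).1 => //; exact: mfab.
  - move=> k x /=; rewrite in_itv/= => xab; rewrite /g patchE.
    by case: ifPn => // _; rewrite lee_fin f0.
  - move=> x /=; rewrite in_itv/= => xab k l mn; rewrite /g !patchE.
    case: ifPn => [xm|_]; last by case: ifPn => // _; rewrite lee_fin f0.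
    rewrite ifT//; move: xm; rewrite !inE/= !in_itv/= => /andP[cmx ->].
    rewrite andbT (le_trans _ cmx)// /c lerD2l ler_pM2l ?subr_gt0//.
    by rewrite lef_pV2 ?posrE// ler_nat.
have lim2 : (F b - F (c n))%:E @[n --> \oo] --> (F b - F a)%:E.
  apply: cvg_EFin; first by near=> m.
  apply: cvgB; first exact: cvg_cst.
  by have /cvg_at_rightP := Fa; apply; split.
have e : (fun n => \int[mu]_(x in `]a, b]) g n x)%E = (fun n => (F b - F (c n))%:E).
  by apply/funext => n; exact: gE.
rewrite e in lim1.
exact: (cvg_unique _ lim1 lim2).
Unshelve. all: by end_near. Qed.

End SingularFTC.
(** * Powers against exponentials *)

Section PowerExponential.
Context {R : realType}.
Implicit Types (h x y z t : R).
Local Notation mu := (@lebesgue_measure R).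

Lemma continuous_norm_powR h : 0 < h -> continuous (fun v : R => `|v| `^ h).
Proof.
move=> h0 x; have [->|x0] := eqVneq x 0.
  suff : `|v| `^ h @[v --> (0 : R)] --> (0 : R).
    by rewrite /continuous_at normr0 powR0 ?gt_eqF.
  apply/cvgrPdist_lt => e e0; near=> v.
  rewrite sub0r normrN ger0_norm ?powR_ge0//.
  have eE : (e `^ h^-1) `^ h = e by rewrite -powRrM mulVf ?gt_eqF// powRr1 ?ltW.
  rewrite -[ltRHS]eE gt0_ltr_powR ?nnegrE ?powR_ge0//.
  by near: v; apply: (@nbhs0_lt R R); rewrite powR_gt0.
apply: (@continuous_comp _ _ _ (fun v : R => `|v|) (fun u => u `^ h)).
  exact: norm_continuous.
apply: is_derive_continuous; apply: is_derive1_powR; by rewrite normr_gt0.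
Unshelve. all: by end_near. Qed.

(** A bound by a polynomial, whose integral against an exponential is explicit,
    replaces every growth estimate on [|x|^h]. *)
Lemma norm_powR_le h x : 0 <= h <= 2 -> `|x| `^ h <= 1 + x ^+ 2.
Proof.
move=> /andP[h0 h2]; have [x1|x1] := leP `|x| 1.
  rewrite (@le_trans _ _ 1) ?lerDl ?sqr_ge0//.
  have <- : (1 : R) `^ h = 1 by rewrite powR1.
  by rewrite ge0_ler_powR ?nnegrE.
rewrite (@le_trans _ _ (`|x| `^ 2))//; first by rewrite ler_powR// ltW.
by rewrite powR_mulrn// real_normK ?num_real// lerDr.
Qed.

Lemma sqr_expR_bound t : 0 <= t -> 1 + t ^+ 2 <= 8 * expR (t / 2).
Proof.
move=> t0; have := @expR_ge1Dxn R (t / 2) 1 (divr_ge0 t0 (ler0n _ 2)).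
by rewrite expr_div_n (_ : 2`! = 2)%N// => ?; nra.
Qed.

Lemma cvg_sqr_expR : (expR (- t) * (1 + t ^+ 2)) @[t --> +oo] --> (0 : R).
Proof.
have e2 : 8 * expR (- (t / 2)) @[t --> +oo] --> (0 : R).
  rewrite -[X in _ --> X](mulr0 8); apply: cvgM; first exact: cvg_cst.
  apply: (@cvg_comp _ _ _ (fun t : R => t / 2) (fun s => expR (- s))
    _ (+oo%R)); last exact: cvgr_expR.
  by apply: gt0_cvgMly => //; exact: cvg_id.
apply: squeeze_cvgr (cvg_cst 0) e2; near=> t.
have t0 : 0 <= t by near: t; exact: nbhs_pinfty_ge.
rewrite mulr_ge0 ?expR_ge0 ?addr_ge0 ?sqr_ge0//=.
have -> : expR (- t) = expR (- (t / 2)) * expR (- (t / 2)).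
  by rewrite -expRD; congr expR; lra.
have -> : 8 * expR (- (t / 2)) = expR (- (t / 2)) * expR (- (t / 2)) * (8 * expR (t / 2)).
  rewrite -!mulrA [_ * (8 * _)]mulrCA -expRD addNr expR0 mulr1; ring.
by rewrite ler_wpM2l ?mulr_ge0 ?expR_ge0// sqr_expR_bound.
Unshelve. all: by end_near. Qed.

End PowerExponential.
(** * Integration by parts for the incomplete Gamma integrals *)

Section IncompleteGamma.
Context {R : realType}.
Variable h : R.
Hypothesis h_gt0 : 0 < h.
Hypothesis h_lt2 : h < 2.
Implicit Types (x y z t : R).
Local Notation mu := (@lebesgue_measure R).

Let h_bound : 0 <= h <= 2. Proof. by rewrite !ltW. Qed.

Definition exp_pow v : R := expR v * `|v| `^ h.

Lemma continuous_exp_pow : continuous exp_pow.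
Proof.
move=> x; apply: cvgM; first exact: continuous_expR.
exact: continuous_norm_powR.
Qed.

Lemma exp_pow_ge0 v : 0 <= exp_pow v.
Proof. by rewrite mulr_ge0 ?expR_ge0 ?powR_ge0. Qed.

Let is_derive_norm_powR z : 0 < z ->
  is_derive z 1 (fun v : R => `|v| `^ h) (h * z `^ (h - 1)).
Proof.
move=> z0; have := @is_derive1_powR R h z z0.
apply: near_eq_is_derive; near=> v.
by rewrite ger0_norm//; apply: ltW; near: v; exact: lt_nbhsr.
Unshelve. all: by end_near. Qed.

Let Pr := primitive exp_pow.

Let is_derive_Pr z : is_derive z 1 Pr (exp_pow z).
Proof. exact/is_derive_primitive/continuous_exp_pow. Qed.

(** [h * int_0^z w^(h - 1) e^(- w) dw] for [z >= 0], in the form given by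
    integration by parts: the remaining integral has a continuous integrand, so
    differentiability away from [0] and continuity at [0] are immediate. *)
Definition scaled_lower_gamma z : R := expR (- z) * `|z| `^ h - Pr (- z).
(** The same with [e^w] instead of [e^(- w)]. *)
Definition scaled_growing_gamma z : R := expR z * `|z| `^ h - Pr z.

Lemma is_derive_scaled_lower_gamma z : 0 < z ->
  is_derive z 1 scaled_lower_gamma (h * (z `^ (h - 1) * expR (- z))).
Proof.
move=> z0; have -> : h * (z `^ (h - 1) * expR (- z)) =
  (- expR (- z)) * `|z| `^ h + expR (- z) * (h * z `^ (h - 1))
  + - (- exp_pow (- z)).
  by rewrite /exp_pow normrN; ring.
apply: is_derive_addfun.
  apply: is_derive_mulfun; last exact: is_derive_norm_powR.
  have := @is_derive_expRM _ (-1) z.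
  by rewrite !mulN1r; under eq_fun do rewrite mulN1r.
apply: is_deriveN.
have := @is_derive_scalearg _ Pr (-1) z (exp_pow (- z)).
rewrite !mulN1r; under eq_fun do rewrite mulN1r; apply; exact: is_derive_Pr.
Qed.

Lemma is_derive_scaled_growing_gamma z : 0 < z ->
  is_derive z 1 scaled_growing_gamma (h * (expR z * z `^ (h - 1))).
Proof.
move=> z0; have -> : h * (expR z * z `^ (h - 1)) =
  expR z * `|z| `^ h + expR z * (h * z `^ (h - 1)) + - exp_pow z.
  by rewrite /exp_pow; ring.
apply: is_derive_addfun.
  apply: is_derive_mulfun; last exact: is_derive_norm_powR.
by apply: is_deriveN; exact: is_derive_Pr.
Qed.

Let continuous_Pr : continuous Pr.
Proof. by move=> z; exact: is_derive_continuous (is_derive_Pr z). Qed.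

Lemma continuous_scaled_lower_gamma : continuous scaled_lower_gamma.
Proof.
move=> z; apply: cvgB.
  apply: cvgM; last exact: continuous_norm_powR.
  by apply: continuous_comp; [exact: oppr_continuous|exact: continuous_expR].
by apply: continuous_comp; [exact: oppr_continuous|exact: continuous_Pr].
Qed.

Lemma continuous_scaled_growing_gamma : continuous scaled_growing_gamma.
Proof.
move=> z; apply: cvgB; last exact: continuous_Pr.
apply: cvgM; last exact: continuous_norm_powR.
exact: continuous_expR.
Qed.

Lemma scaled_lower_gamma0 : scaled_lower_gamma 0 = 0.
Proof.
by rewrite /scaled_lower_gamma normr0 powR0 ?gt_eqF// mulr0 oppr0 /Pr primitive0 subrr.
Qed.

Lemma scaled_growing_gamma0 : scaled_growing_gamma 0 = 0.
Proof.
by rewrite /scaled_growing_gamma normr0 powR0 ?gt_eqF// mulr0 /Pr primitive0 subrr.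
Qed.

Let measurable_gamma_density :
  measurable_fun setT (fun w : R => h * (w `^ (h - 1) * expR (- w))).
Proof.
apply: measurable_funM => //; apply: measurable_funM.
  exact: measurable_powR.
by apply: measurableT_comp => //; exact: measurable_expR.
Qed.

Let continuous_powR1 z : 0 < z -> {for z, continuous (fun w : R => w `^ (h - 1))}.
Proof. by move=> z0; exact: is_derive_continuous (is_derive1_powR _ z0). Qed.

Let continuous_gamma_density z : 0 < z ->
  {for z, continuous (fun w : R => h * (w `^ (h - 1) * expR (- w)))}.
Proof.
move=> z0; apply: cvgM; first exact: cvg_cst.
apply: cvgM; first exact: continuous_powR1.
by apply: continuous_comp; [exact: oppr_continuous|exact: continuous_expR].
Qed.

Lemma integral_gamma_density a b : 0 <= a -> a < b ->
  (\int[mu]_(w in `[a, b]) (h * (w `^ (h - 1) * expR (- w)))%:E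
   = (scaled_lower_gamma b - scaled_lower_gamma a)%:E)%E.
Proof.
move=> a0 ab; apply: ge0_singular_FTC2 => //.
- by move=> x _; rewrite !mulr_ge0 ?powR_ge0 ?expR_ge0 ?ltW.
- by move=> x /andP[ax _]; apply: continuous_gamma_density; exact: le_lt_trans ax.
- by move=> x /andP[ax _]; apply: is_derive_scaled_lower_gamma; exact: le_lt_trans ax.
- exact/cvg_at_right_filter/continuous_scaled_lower_gamma.
Qed.

Lemma scaled_lower_gamma_nondecreasing a b : 0 <= a -> a <= b ->
  scaled_lower_gamma a <= scaled_lower_gamma b.
Proof.
move=> a0; rewrite le_eqVlt => /predU1P[->//|ab].
rewrite -subr_ge0 -lee_fin -(integral_gamma_density a0 ab).
by apply: integral_ge0 => x _; rewrite lee_fin !mulr_ge0 ?powR_ge0 ?expR_ge0 ?ltW.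
Qed.

(** The bound comes from [|v|^h <= 1 + v^2] and from the antiderivative
    [e^v (v^2 - 2 v + 3)] of [e^v (1 + v^2)], whose value at [0] is [3]. *)
Lemma scaled_lower_gamma_le3 z : 0 <= z -> scaled_lower_gamma z <= 3.
Proof.
move=> z0; rewrite /scaled_lower_gamma.
have P0 : Pr (- z) = - \int[mu]_(v in `[- z, 0]) exp_pow v.
  rewrite /Pr /primitive oppr_ge0; case: ifPn => // zle0.
  have -> : z = 0 by apply/eqP; rewrite eq_le z0 zle0.
  by rewrite oppr0 set_itv1 Rintegral_set1 oppr0.
pose B v : R := expR v * (1 + v ^+ 2).
have cB : continuous B.
  move=> x; apply: cvgM; first exact: continuous_expR.
  by apply: cvgD; [exact: cvg_cst|exact: exprn_continuous].
have IB : \int[mu]_(v in `[- z, 0]) B v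
    = expR 0 * (0 * 0 - 2 * 0 + 3) - expR (- z) * ((- z) * (- z) - 2 * (- z) + 3).
  apply: (@Rintegral_derive _ B (fun v => expR v * (v * v - 2 * v + 3))) => //.
    by rewrite oppr_le0.
  move=> x _; have -> : B x = expR x * (x * x - 2 * x + 3)
      + expR x * (1 * x + x * 1 + - (2 * 1) + 0).
    by rewrite /B; ring.
  apply: is_derive_mulfun; apply: is_derive_addfun; apply: is_derive_addfun.
    exact: is_derive_mulfun.
have le : \int[mu]_(v in `[- z, 0]) exp_pow v <= \int[mu]_(v in `[- z, 0]) B v.
  apply: le_Rintegral => //.
  - exact/continuous_itv_integrable/continuous_exp_pow.
  - exact: continuous_itv_integrable.
  - move=> v _; rewrite /exp_pow /B ler_wpM2l ?expR_ge0//.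
    exact: norm_powR_le.
have le2 : expR (- z) * `|z| `^ h <= expR (- z) * (1 + z ^+ 2).
  by rewrite ler_wpM2l ?expR_ge0// norm_powR_le.
move: le; rewrite IB P0 expR0; move: (expR_ge0 (- z)) => e0.
move: le2; nra.
Qed.

End IncompleteGamma.
(** * Complete and upper Gamma integrals *)

Section GammaLimits.
Context {R : realType}.
Variable h : R.
Hypothesis h_gt0 : 0 < h.
Hypothesis h_lt2 : h < 2.
Implicit Types (x y z t : R).
Local Notation mu := (@lebesgue_measure R).

(** Monotone and bounded; the limit is identified with [h * Gamma h] only after
    the upper incomplete Gamma integral has been computed from it. *)
Lemma scaled_lower_gamma_cvg : exists L : R, scaled_lower_gamma h x @[x --> +oo] --> L.
Proof.
pose g x := scaled_lower_gamma h (Num.max 0 x).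
have ndg : nondecreasing_fun g.
  move=> x y xy; apply: scaled_lower_gamma_nondecreasing => //.
    by rewrite le_max lexx.
  by rewrite ge_max !le_max lexx xy orbT.
have ubg : has_ubound (range g).
  by exists 3 => _ [x _ <-]; apply: scaled_lower_gamma_le3 => //; rewrite le_max lexx.
exists (sup (range g)); have := nondecreasing_cvgr ndg ubg.
apply: cvg_trans; apply: near_eq_cvg; near=> x.
rewrite /g max_r//; near: x; exact: nbhs_pinfty_ge.
Unshelve. all: by end_near. Qed.

Lemma integral_gamma_density_oo L z :
  scaled_lower_gamma h x @[x --> +oo] --> L -> 0 <= z ->
  (\int[mu]_(w in `[z, +oo[) (h * (w `^ (h - 1) * expR (- w)))%:E
   = (L - scaled_lower_gamma h z)%:E)%E.
Proof.
move=> cvgL z0; have z1 : 0 < z + 1 by rewrite ltr_wpDl.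
have mf (D : set R) :
    measurable_fun D (fun w : R => (h * (w `^ (h - 1) * expR (- w)))%:E).
  apply/measurable_EFinP; apply: measurable_funTS.
  apply: measurable_funM => //; apply: measurable_funM.
    exact: measurable_powR.
  by apply: measurableT_comp => //; exact: measurable_expR.
have f0 w : (0 <= (h * (w `^ (h - 1) * expR (- w)))%:E)%E.
  by rewrite lee_fin !mulr_ge0 ?powR_ge0 ?expR_ge0 ?ltW.
have I1 : (\int[mu]_(w in `[(z + 1)%R, +oo[)
     (h * (w `^ (h - 1) * expR (- w)))%:E = (L - scaled_lower_gamma h (z + 1))%:E)%E.
  apply: ge0_continuous_FTC2y => //.
  - by move=> x _; have := f0 x; rewrite lee_fin.
  - apply: continuous_in_subspaceT => x; rewrite inE/= in_itv/= andbT => zx.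
    have x0 : 0 < x by exact: lt_le_trans zx.
    apply: cvgM; first exact: cvg_cst.
    apply: cvgM; last first.
      by apply: continuous_comp; [exact: oppr_continuous|exact: continuous_expR].
    exact: is_derive_continuous (is_derive1_powR _ x0).
  - move=> x zx; apply: ex_derive; apply: is_derive_scaled_lower_gamma => //.
    exact: lt_trans zx.
  - apply: cvg_at_right_filter; exact: continuous_scaled_lower_gamma.
  - move=> x; rewrite in_itv/= andbT => zx; rewrite derive1E.
    apply: derive_val; apply: is_derive_scaled_lower_gamma => //.
    exact: lt_trans zx.
(* [w^(h - 1)] may be singular at [z = 0]: the half-line is cut at [z + 1]. *)
have zz : z < z + 1 by rewrite ltrDl.
have -> : [set` `[z, +oo[] = [set` `[z, z + 1[] `|` [set` `[z + 1, +oo[] :> set R.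
  by rewrite -itv_bndbnd_setU// bnd_simp ltW.
rewrite ge0_integral_setU//=; last first.
  apply/disj_setPS => y [/=]; rewrite !in_itv/= => /andP[_ yx] /andP[].
  by rewrite leNgt yx.
  exact: mf.
rewrite I1 integral_itv_bndo_bndc// integral_gamma_density//.
by rewrite -EFinD; congr EFin; ring.
Qed.

(** Finiteness of the integral of [f] is part of the conclusion: an infinite one
    would stay infinite after multiplication by [h]. *)
Lemma Rintegral_unscale (D : set R) (f : R -> R) (r : R) :
  measurable D -> measurable_fun D f -> (forall x, D x -> 0 <= f x) ->
  (\int[mu]_(w in D) (h * f w)%:E = r%:E)%E ->
  h * \int[mu]_(w in D) f w = r.
Proof.
move=> mD mf f0; under eq_integral do rewrite EFinM.
rewrite ge0_integralZl//; last 2 first.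
- exact/measurable_EFinP.
- by rewrite lee_fin ltW.
rewrite /Rintegral; case: (\int[mu]_(w in D) (f w)%:E)%E => [s| |] //=.
- by move=> [].
- by rewrite gt0_muley ?lte_fin.
- by rewrite gt0_muleNy ?lte_fin.
Qed.

Lemma upper_GammaE L z :
  scaled_lower_gamma h x @[x --> +oo] --> L -> 0 <= z ->
  h * upper_Gamma h z = L - scaled_lower_gamma h z.
Proof.
move=> cvgL z0; apply: Rintegral_unscale => //.
- apply: measurable_funTS; apply: measurable_funM.
    exact: measurable_powR.
  by apply: measurableT_comp => //; exact: measurable_expR.
- by move=> x _; rewrite mulr_ge0 ?powR_ge0 ?expR_ge0.
- exact: integral_gamma_density_oo.
Qed.

Lemma scaled_growing_gammaE z : 0 <= z ->
  h * \int[mu]_(w in `[0, z]) (expR w * w `^ (h - 1)) = scaled_growing_gamma h z.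
Proof.
rewrite le_eqVlt => /predU1P[<-|z0].
  by rewrite set_itv1 Rintegral_set1 mulr0 scaled_growing_gamma0.
have mf : measurable_fun setT (fun w : R => expR w * w `^ (h - 1)).
  by apply: measurable_funM; [exact: measurable_expR|exact: measurable_powR].
apply: Rintegral_unscale => //.
- exact: measurable_funTS.
- by move=> x _; rewrite mulr_ge0 ?powR_ge0 ?expR_ge0.
- have -> : scaled_growing_gamma h z = scaled_growing_gamma h z - scaled_growing_gamma h 0.
    by rewrite scaled_growing_gamma0// subr0.
  apply: ge0_singular_FTC2 => //.
  + by apply: measurable_funM.
  + by move=> x _; rewrite !mulr_ge0 ?powR_ge0 ?expR_ge0 ?ltW.
  + move=> x /andP[x0 _]; apply: cvgM; first exact: cvg_cst.
    apply: cvgM; first exact: continuous_expR.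
    exact: is_derive_continuous (is_derive1_powR _ x0).
  + by move=> x /andP[x0 _]; exact: is_derive_scaled_growing_gamma.
  + exact/cvg_at_right_filter/continuous_scaled_growing_gamma.
Qed.

(** [int_(-oo)^x e^v |v|^h dv]: its value at [0] is [Gamma (h + 1) = h * Gamma h],
    and the rest is an integral over a bounded interval. *)
Definition exp_pow_primitive x : R := h * Gamma h + primitive (exp_pow h) x.
Local Notation P1 := exp_pow_primitive.

Lemma is_derive_exp_pow_primitive x : is_derive x 1 P1 (exp_pow h x).
Proof.
rewrite -[exp_pow h x]add0r; apply: is_derive_addfun.
exact/is_derive_primitive/continuous_exp_pow.
Qed.

Let cvg_GammaE : scaled_lower_gamma h x @[x --> +oo] --> h * Gamma h.
Proof.
have [L cvgL] := scaled_lower_gamma_cvg.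
have := upper_GammaE cvgL (lexx 0); rewrite scaled_lower_gamma0// subr0.
by rewrite -/(Gamma h) => ->.
Qed.

Lemma exp_pow_primitiveN z : 0 <= z ->
  P1 (- z) = expR (- z) * z `^ h + h * upper_Gamma h z.
Proof.
move=> z0; rewrite (upper_GammaE cvg_GammaE z0)/scaled_lower_gamma/P1 ger0_norm//.
ring.
Qed.

Lemma exp_pow_primitiveE z : 0 <= z ->
  P1 z = h * Gamma h + expR z * z `^ h
    - h * \int[mu]_(w in `[0, z]) (expR w * w `^ (h - 1)).
Proof.
move=> z0; rewrite scaled_growing_gammaE// /scaled_growing_gamma /P1 ger0_norm//; ring.
Qed.

Lemma cvg_exp_pow_primitiveN : P1 (- z) @[z --> +oo] --> 0.
Proof.
have cP : (expR (- z) * `|z| `^ h + (h * Gamma h - scaled_lower_gamma h z))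
    @[z --> +oo] --> (0 : R).
  rewrite -[X in _ --> X]addr0; apply: cvgD; last first.
    rewrite -[X in _ --> X](subrr (h * Gamma h)).
    by apply: cvgB; [exact: cvg_cst|exact: cvg_GammaE].
  apply: squeeze_cvgr (cvg_cst 0) (@cvg_sqr_expR R); near=> t.
  rewrite mulr_ge0 ?powR_ge0 ?expR_ge0//= ler_wpM2l ?expR_ge0//.
  by rewrite norm_powR_le// !ltW.
have e : (fun z => P1 (- z)) = (fun z => (expR (- z) * `|z| `^ h + (h * Gamma h - scaled_lower_gamma h z))).
  by apply/funext => z; rewrite /P1 /scaled_lower_gamma; ring.
by rewrite e.
Unshelve. all: by end_near. Qed.

Lemma cvg_exp_pow_primitive : expR (- (2 * z)) * P1 z @[z --> +oo] --> 0.
Proof.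
have G0 : 0 <= Gamma h.
  by apply: Rintegral_ge0 => x _; rewrite mulr_ge0 ?powR_ge0 ?expR_ge0.
have l : (h * Gamma h * expR (- z) + expR (- z) * (1 + z ^+ 2))
    @[z --> +oo] --> (0 : R).
  rewrite -[X in _ --> X]addr0; apply: cvgD; last exact: cvg_sqr_expR.
  rewrite -[X in _ --> X](mulr0 (h * Gamma h)).
  by apply: cvgM; [exact: cvg_cst|exact: cvgr_expR].
apply: squeeze_cvgr (cvg_cst 0) l; near=> z.
have z0 : 0 <= z by near: z; exact: nbhs_pinfty_ge.
have p0 : 0 <= P1 z.
  rewrite /P1 addr_ge0// ?mulr_ge0 ?(ltW h_gt0)// /primitive z0.
  by apply: Rintegral_ge0 => x _; exact: exp_pow_ge0.
rewrite mulr_ge0 ?expR_ge0//=.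
have J0 : 0 <= \int[mu]_(w in `[0, z]) (expR w * w `^ (h - 1)).
  by apply: Rintegral_ge0 => x _; rewrite mulr_ge0 ?powR_ge0 ?expR_ge0.
have P1le : P1 z <= h * Gamma h + expR z * (1 + z ^+ 2).
  rewrite exp_pow_primitiveE// lerBlDr.
  apply: (@le_trans _ _ (h * Gamma h + expR z * (1 + z ^+ 2))); last first.
    by rewrite lerDl mulr_ge0// ltW.
  rewrite lerD2l ler_wpM2l ?expR_ge0//.
  by rewrite -{1}(ger0_norm z0) norm_powR_le// !ltW.
apply: (@le_trans _ _ (expR (- (2 * z)) * (h * Gamma h + expR z * (1 + z ^+ 2)))).
  by rewrite ler_wpM2l ?expR_ge0.
rewrite mulrDr lerD//.
  rewrite mulrC ler_wpM2l ?mulr_ge0 ?(ltW h_gt0)// ler_expR; lra.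
by rewrite mulrA -expRD (_ : - (2 * z) + z = - z)//; ring.
Unshelve. all: by end_near. Qed.

End GammaLimits.
(** * The covariance function of the stationary solution *)

Section StationaryCovariance.
Context {R : realType}.
Variables h th : R.
Hypothesis h_gt0 : 0 < h.
Hypothesis h_lt2 : h < 2.
Hypothesis th_gt0 : 0 < th.
Implicit Types (r s t u tau : R).
Local Notation mu := (@lebesgue_measure R).
Local Notation phi := (fun r : R => `|r| `^ h).

(** The moderate solution of [p' = - th * p + phi], rescaled from the case
    [th = 1]. *)
Let p r : R := (th `^ h * th)^-1 * (expR (- th * r) * exp_pow_primitive h (th * r)).
Let q r : R := p (- r).

(** [th / 2 * (p + q)] is the convolution of [phi] with the Laplace density
    [th / 2 * e^(- th |r|)]. *)
Definition stationary_cov r : R := (th / 2 * (p r + q r) - phi r) / 2.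
Local Notation C := stationary_cov.

(** The absolute values make the covariance of fractional Brownian motion a
    continuous function on the whole line. *)
Definition fbm_cov s u : R := 2^-1 * (phi s + phi u - phi (u - s)).

Let is_derive_p r : is_derive r 1 p (- th * p r + phi r).
Proof.
have -> : - th * p r + phi r = (th `^ h * th)^-1 *
  (- th * expR (- th * r) * exp_pow_primitive h (th * r)
   + expR (- th * r) * (th * exp_pow h (th * r))).
  rewrite /p /exp_pow normrM powRM// (gtr0_norm th_gt0) !mulNr expRN.
  have e0 : expR (th * r) != 0 by rewrite gt_eqF ?expR_gt0.
  have t0 : th `^ h != 0 by rewrite gt_eqF ?powR_gt0.
  have t1 : th != 0 by rewrite gt_eqF.
  by field; rewrite e0 t0 t1.
apply: is_derive_scalefun; apply: is_derive_mulfun.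
  exact: is_derive_expRM.
by apply: is_derive_scalearg; exact: is_derive_exp_pow_primitive.
Qed.

Let is_derive_q r : is_derive r 1 q (th * q r - phi r).
Proof.
have := @is_derive_scalearg _ p (-1) r _ (is_derive_p (-1 * r)).
rewrite !mulN1r; under eq_fun do rewrite mulN1r.
by rewrite normrN opprD mulNr opprK.
Qed.

Let continuous_q : continuous q.
Proof. by move=> r; exact: is_derive_continuous (is_derive_q r). Qed.

Let continuous_phi : continuous phi.
Proof. exact: continuous_norm_powR. Qed.

Lemma continuous_fbm_cov u : continuous (fbm_cov ^~ u).
Proof.
move=> s; apply: cvgM; first exact: cvg_cst.
apply: cvgB; first by apply: cvgD; [exact: continuous_phi|exact: cvg_cst].
apply: (@continuous_comp _ _ _ (fun s => u - s) phi); last exact: continuous_phi.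
by apply: cvgB; [exact: cvg_cst|exact: cvg_id].
Qed.

Let continuous_weight t : continuous (fun s : R => expR (th * (s - t))).
Proof.
move=> s; apply: (@continuous_comp _ _ _ (fun s => th * (s - t)) expR).
  by apply: cvgM; [exact: cvg_cst|apply: cvgB; [exact: cvg_id|exact: cvg_cst]].
exact: continuous_expR.
Qed.

Let is_derive_weight t s :
  is_derive s 1 (fun s : R => expR (th * (s - t))) (th * expR (th * (s - t))).
Proof.
apply: (@is_derive_subarg _ (fun s => expR (th * s))).
exact: is_derive_expRM.
Qed.

Lemma continuous_weight_fbm_cov t u :
  continuous (fun s => expR (th * (s - t)) * fbm_cov s u).
Proof.
by move=> s; apply: cvgM; [exact: continuous_weight|exact: continuous_fbm_cov].
Qed.

(** The covariance of [Y_t] and [W_u], for [sigma = 1]. *)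
Let mixed_cov t u : R :=
  2^-1 * (phi t - th * p t - phi (u - t) + th * q (u - t)
          + expR (- th * t) * (th * p 0 + phi u - th * q u)).

Let integral_weight_fbm_cov t u : 0 <= t ->
  fbm_cov t u - th * \int[mu]_(s in `[0, t]) (expR (th * (s - t)) * fbm_cov s u)
  = mixed_cov t u.
Proof.
move=> t0.
pose F s := expR (th * (s - t)) * (2^-1 * (p s + phi u / th + - q (u - s))).
(* [e^(th s) p s] and [- e^(th s) q (u - s)] are antiderivatives of
   [e^(th s) phi s] and of [- e^(th s) phi (u - s)]. *)
have dF s : is_derive s 1 F (expR (th * (s - t)) * fbm_cov s u).
  have -> : expR (th * (s - t)) * fbm_cov s u =
    th * expR (th * (s - t)) * (2^-1 * (p s + phi u / th + - q (u - s)))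
    + expR (th * (s - t)) * (2^-1 * (- th * p s + phi s + 0
        + - - (th * q (u - s) - phi (u - s)))).
    rewrite /fbm_cov; have t1 : th != 0 by rewrite gt_eqF.
    by field.
  apply: is_derive_mulfun; first exact: is_derive_weight.
  apply: is_derive_scalefun; apply: is_derive_addfun.
    exact: is_derive_addfun.
  by apply: is_deriveN; apply: is_derive_reflarg; exact: is_derive_q.
rewrite (Rintegral_derive t0 (@continuous_weight_fbm_cov t u) (fun s _ => dF s)).
rewrite /F subrr mulr0 expR0 sub0r mulrN -mulNr /mixed_cov /fbm_cov subr0.
have t1 : th != 0 by rewrite gt_eqF.
by field.
Qed.

Let continuous_mixed_cov t : continuous (mixed_cov t).
Proof.
have sub v : continuous (fun u : R => u - v).
  by move=> u; apply: cvgB; [exact: cvg_id|exact: cvg_cst].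
move=> u; apply: cvgM; first exact: cvg_cst.
apply: cvgD; last first.
  apply: cvgM; first exact: cvg_cst.
  apply: cvgB.
    by apply: cvgD; [exact: cvg_cst|exact: continuous_phi].
  by apply: cvgM; [exact: cvg_cst|exact: continuous_q].
apply: cvgD; last first.
  apply: cvgM; first exact: cvg_cst.
  by apply: (@continuous_comp _ _ _ (fun u : R => u - t) q); [exact: sub|exact: continuous_q].
apply: cvgB; first exact: cvg_cst.
by apply: (@continuous_comp _ _ _ (fun u : R => u - t) phi); [exact: sub|exact: continuous_phi].
Qed.

Let integral_weight_mixed_cov t t' : 0 <= t' ->
  mixed_cov t t' - th * \int[mu]_(u in `[0, t']) (expR (th * (u - t')) * mixed_cov t u)
  = C (t' - t) - expR (- th * t) * C t' - expR (- th * t') * C t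
    + expR (- th * t) * expR (- th * t') * C 0.
Proof.
move=> t0; have th0 : th != 0 by rewrite gt_eqF.
(* [X] solves [X' + th X = q'], so that [e^(th u) X] has derivative
   [e^(th u) q']. *)
pose X r := 2^-1 * (q r + - p r).
have dX r : is_derive r 1 X (th * q r - phi r + - th * X r).
  have -> : th * q r - phi r + - th * X r =
    2^-1 * (th * q r - phi r + - (- th * p r + phi r)) by rewrite /X; field.
  apply: is_derive_scalefun; apply: is_derive_addfun; first exact: is_derive_q.
  by apply: is_deriveN; exact: is_derive_p.
pose A := phi t - th * p t + expR (- th * t) * (th * p 0).
pose F u := expR (th * (u - t')) *
   (2^-1 * (A / th + X (u - t) + - (expR (- th * t) * X u))).
have cF : continuous (fun u => expR (th * (u - t')) * mixed_cov t u).
  by move=> u; apply: cvgM; [exact: continuous_weight|exact: continuous_mixed_cov].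
have dF u : is_derive u 1 F (expR (th * (u - t')) * mixed_cov t u).
  have -> : expR (th * (u - t')) * mixed_cov t u =
    th * expR (th * (u - t'))
      * (2^-1 * (A / th + X (u - t) + - (expR (- th * t) * X u)))
    + expR (th * (u - t'))
      * (2^-1 * (0 + (th * q (u - t) - phi (u - t) + - th * X (u - t))
       + - (expR (- th * t) * (th * q u - phi u + - th * X u)))).
    by rewrite /mixed_cov /A; field.
  apply: is_derive_mulfun; first exact: is_derive_weight.
  apply: is_derive_scalefun; apply: is_derive_addfun.
  by apply: is_derive_addfun; apply: is_derive_subarg; exact: dX.
rewrite (Rintegral_derive t0 cF (fun u _ => dF u)).
rewrite /F subrr mulr0 expR0 sub0r mulrN -mulNr /X sub0r.
rewrite /stationary_cov /mixed_cov /A /q !(subr0, oppr0, opprK, normr0) powR0 ?gt_eqF//.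
clearbody p; by field.
Qed.

Definition solution_noise_cov t u : R := fbm_cov t u
  - th * \int[mu]_(s in `[0, t]) (expR (th * (s - t)) * fbm_cov s u).

Let solution_noise_covE t : 0 <= t -> solution_noise_cov t = mixed_cov t.
Proof. by move=> t0; apply/funext => u; exact: integral_weight_fbm_cov. Qed.

Lemma continuous_weight_solution_noise_cov t t' : 0 <= t ->
  continuous (fun u => expR (th * (u - t')) * solution_noise_cov t u).
Proof.
move=> t0; rewrite solution_noise_covE// => u.
by apply: cvgM; [exact: continuous_weight|exact: continuous_mixed_cov].
Qed.

(** The right-hand side is the covariance of [X_t - e^(- th t) X_0] and
    [X_t' - e^(- th t') X_0] for a process [X] with covariance function [C]. *)
Lemma transient_cov t t' : 0 <= t -> 0 <= t' ->
  solution_noise_cov t t' - th *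
    \int[mu]_(u in `[0, t']) (expR (th * (u - t')) * solution_noise_cov t u)
  = C (t' - t) - expR (- th * t) * C t' - expR (- th * t') * C t
    + expR (- th * t) * expR (- th * t') * C 0.
Proof.
move=> t0 t'0; rewrite solution_noise_covE//; exact: integral_weight_mixed_cov.
Qed.

Lemma cvg_expR_stationary_cov : expR (- th * t) * C t @[t --> +oo] --> 0.
Proof.
have cth : th * t @[t --> +oo] --> +oo.
  by apply: gt0_cvgMry => //; exact: cvg_id.
have thh0 : th `^ h != 0 by rewrite gt_eqF ?powR_gt0.
have th0 : th != 0 by rewrite gt_eqF.
pose k := (th `^ h * th)^-1.
have -> : (fun t => expR (- th * t) * C t) = (fun t => th / 4 * k *
    (expR (- (2 * (th * t))) * exp_pow_primitive h (th * t)
     + exp_pow_primitive h (- (th * t)))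
    + - (th `^ h)^-1 / 2 * (expR (- (th * t)) * `|th * t| `^ h)).
  apply/funext => t; rewrite /stationary_cov /q /p -/k normrM powRM// (gtr0_norm th_gt0).
  rewrite !mulrN !mulNr !opprK.
  have -> : expR (- (2 * (th * t))) = expR (- (th * t)) * expR (- (th * t)).
    by rewrite -expRD; congr expR; ring.
  rewrite !expRN; have e0 : expR (th * t) != 0 by rewrite gt_eqF ?expR_gt0.
  by rewrite /k; field; rewrite e0 thh0 th0.
rewrite -[X in _ --> X]addr0; apply: cvgD.
  rewrite -[X in _ --> X](mulr0 (th / 4 * k)); apply: cvgM; first exact: cvg_cst.
  rewrite -[X in _ --> X]addr0; apply: cvgD.
    exact: (cvg_comp _ _ cth (cvg_exp_pow_primitive h_gt0 h_lt2)).
  exact: (cvg_comp _ _ cth (cvg_exp_pow_primitiveN h_gt0 h_lt2)).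
rewrite -[X in _ --> X](mulr0 (- (th `^ h)^-1 / 2)); apply: cvgM; first exact: cvg_cst.
apply: (@cvg_comp _ _ _ _ (fun z : R => expR (- z) * `|z| `^ h) _ _ _ cth).
apply: squeeze_cvgr (cvg_cst 0) (@cvg_sqr_expR R); near=> z.
rewrite mulr_ge0 ?powR_ge0 ?expR_ge0//= ler_wpM2l ?expR_ge0//.
by rewrite norm_powR_le// !ltW.
Unshelve. all: by end_near. Qed.

Lemma cvg_transient_cov tau :
  (C ((t + tau) - t) - expR (- th * t) * C (t + tau) - expR (- th * (t + tau)) * C t
    + expR (- th * t) * expR (- th * (t + tau)) * C 0) @[t --> +oo] --> C tau.
Proof.
have -> : (fun t => C ((t + tau) - t) - expR (- th * t) * C (t + tau)
    - expR (- th * (t + tau)) * C t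
    + expR (- th * t) * expR (- th * (t + tau)) * C 0) =
  (fun t => C tau - expR (th * tau) * (expR (- th * (t + tau)) * C (t + tau))
    - expR (- th * tau) * (expR (- th * t) * C t)
    + expR (- th * tau) * C 0 * (expR (- (th * t)) * expR (- (th * t)))).
  apply/funext => t.
  have -> : t + tau - t = tau by ring.
  have -> : expR (- th * t) = expR (th * tau) * expR (- th * (t + tau)).
    by rewrite -expRD; congr expR; ring.
  have -> : expR (- (th * t)) = expR (th * tau) * expR (- th * (t + tau)).
    by rewrite -expRD; congr expR; ring.
  have -> : expR (- th * tau) = (expR (th * tau))^-1 by rewrite mulNr expRN.
  have e0 : expR (th * tau) != 0 by rewrite gt_eqF ?expR_gt0.
  by field.
have cth : th * t @[t --> +oo] --> +oo.
  by apply: gt0_cvgMry => //; exact: cvg_id.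
have ce : expR (- (th * t)) @[t --> +oo] --> (0 : R).
  exact: (cvg_comp _ _ cth (@cvgr_expR R)).
rewrite -[X in _ --> X]addr0; apply: cvgD; last first.
  rewrite -[X in _ --> X](mulr0 (expR (- th * tau) * C 0)); apply: cvgM.
    exact: cvg_cst.
  by rewrite -[X in _ --> X](mulr0 0); apply: cvgM.
rewrite -[X in _ --> X]subr0; apply: cvgB; last first.
  rewrite -[X in _ --> X](mulr0 (expR (- th * tau))); apply: cvgM.
    exact: cvg_cst.
  exact: cvg_expR_stationary_cov.
rewrite -[X in _ --> X]subr0; apply: cvgB; first exact: cvg_cst.
rewrite -[X in _ --> X](mulr0 (expR (th * tau))); apply: cvgM.
  exact: cvg_cst.
exact: (cvg_comp _ _ (cvg_addrr tau) cvg_expR_stationary_cov).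
Qed.

(** The boundary terms of the integrations by parts for [p tau] and [q tau]
    contribute [phi tau] to [th / 2 * (p tau + q tau)] and cancel. *)
Lemma stationary_covE tau : 0 <= tau ->
  C tau = h / 4 * th `^ (- h) *
   (expR (- th * tau) * Gamma h + expR (th * tau) * upper_Gamma h (th * tau)
    - expR (- th * tau) *
      \int[mu]_(w in `[0, th * tau]) (expR w * w `^ (h - 1))).
Proof.
move=> tau0; have z0 : 0 <= th * tau by rewrite mulr_ge0// ltW.
have thh0 : th `^ h != 0 by rewrite gt_eqF ?powR_gt0.
have th0 : th != 0 by rewrite gt_eqF.
rewrite /stationary_cov /q /p !mulrN exp_pow_primitiveN// exp_pow_primitiveE//.
rewrite ger0_norm// powRM// ?(ltW th_gt0)// powRN !mulNr opprK expRN.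
have e0 : expR (th * tau) != 0 by rewrite gt_eqF ?expR_gt0.
by field; rewrite th0 thh0 e0.
Qed.

End StationaryCovariance.
(** * Solving the equation along a path *)

Section Pathwise.
Context {R : realType}.
Implicit Types (y z : R -> R) (a s t th : R).
Local Notation mu := (@lebesgue_measure R).

Lemma continuous_primitive y : continuous y -> continuous (primitive y).
Proof. by move=> cy t; apply: is_derive_continuous (is_derive_primitive t cy). Qed.

(** With [I t = int_0^t y], the function [e^(th s) (I s - x0 / th)] has
    derivative [e^(th s) z s]; [z] itself is never differentiated. *)
Lemma variation_of_constants y z th (x0 : R) : 0 < th -> continuous y -> continuous z ->
  (forall t, 0 <= t -> y t = x0 - th * \int[mu]_(s in `[0, t]) y s + z t) ->
  forall t, 0 <= t -> y t = expR (- th * t) * x0 + z t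
    - th * \int[mu]_(s in `[0, t]) (expR (th * (s - t)) * z s).
Proof.
move=> th0 cy cz eqy t t0.
have thn0 : th != 0 by rewrite gt_eqF.
pose F s := expR (th * (s - t)) * (primitive y s + - (x0 / th)).
have cf : continuous (fun s => expR (th * (s - t)) * z s).
  move=> s; apply: cvgM; last exact: cz.
  apply: (@continuous_comp _ _ _ (fun s => th * (s - t)) expR).
    by apply: cvgM; [exact: cvg_cst|apply: cvgB; [exact: cvg_id|exact: cvg_cst]].
  exact: continuous_expR.
have dF s : 0 <= s <= t -> is_derive s 1 F (expR (th * (s - t)) * z s).
  move=> /andP[s0 _].
  have -> : expR (th * (s - t)) * z s =
    th * expR (th * (s - t)) * (primitive y s + - (x0 / th))
    + expR (th * (s - t)) * (y s + 0).
    by rewrite {1}(eqy _ s0) /primitive s0; field.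
  apply: is_derive_mulfun.
    apply: (@is_derive_subarg _ (fun s => expR (th * s))).
    exact: is_derive_expRM.
  apply: is_derive_addfun; exact: is_derive_primitive.
rewrite (Rintegral_derive t0 cf dF) /F subrr mulr0 expR0 sub0r mulrN -mulNr.
rewrite primitive0 {1}(eqy _ t0) /primitive t0.
by field.
Qed.

End Pathwise.

(** * Exchanging expectation and path integrals *)

Section JointMeasurability.
Context {d : measure_display} {T : measurableType d} {R : realType}.

(** The process is the pointwise limit of its samples at the times
    [floor (m s) / m], where [m = n + 1]; each sample is measurable because its
    times range over a countable set. *)
Lemma measurable_fun_continuous_path (Z : R -> T -> R) :
  (forall s, measurable_fun setT (Z s)) ->
  (forall w, continuous (Z ^~ w)) ->
  measurable_fun setT (fun p : T * R => Z p.2 p.1).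
Proof.
move=> mZ cZ.
pose c n (s : R) : R := (Num.floor (s * n.+1%:R))%:~R / n.+1%:R.
have cvgc s : c n s @[n --> \oo] --> s.
  have h := @cvg_harmonic R; apply/cvgrPdist_le => e e0; near=> n.
  have n0 : (0 : R) < n.+1%:R by [].
  have /andP[f1 f2] := floor_itv (s * n.+1%:R).
  have -> : s - c n s = (s * n.+1%:R - (Num.floor (s * n.+1%:R))%:~R) / n.+1%:R.
    by rewrite /c; field.
  rewrite ger0_norm; last by rewrite divr_ge0// subr_ge0.
  apply: (@le_trans _ _ (n.+1%:R^-1)).
    by rewrite ler_pdivrMr// mulVf ?gt_eqF// lerBlDl ltW// -intrD1.
  near: n; exact: (cvgr_le _ h).
have mc n : measurable_fun setT (fun p : T * R => Z (c n p.2) p.1).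
  move=> _ B mB; rewrite setTI.
  pose k (j : int) : R := j%:~R / n.+1%:R.
  have -> : (fun p : T * R => Z (c n p.2) p.1) @^-1` B =
    \bigcup_(j in [set: int])
      ((Z (k j) @^-1` B) `*` ((fun s : R => Num.floor (s * n.+1%:R)) @^-1` [set j])).
    apply/seteqP; split => [[w s] /= Bs|[w s] /= [j _ [/= Bj fj]]].
      by exists (Num.floor (s * n.+1%:R)).
    by rewrite /c fj.
  apply: countable_bigcupT_measurable => [|j]; first exact: countableP.
  apply: measurableX.
    by rewrite -[X in measurable X]setTI; exact: mZ.
  have -> : (fun s : R => Num.floor (s * n.+1%:R)) @^-1` [set j] =
      [set` `[k j, k (j + 1)[].
    have n0 : (0 : R) < n.+1%:R by [].
    apply/seteqP; split => s /=; rewrite in_itv/= /k ler_pdivrMr// ltr_pdivlMr//.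
      by move=> <-; exact: floor_itv.
    exact: floor_def.
  exact: measurable_itv.
apply/measurable_EFinP.
apply: (emeasurable_fun_cvg (fun n (p : T * R) => (Z (c n p.2) p.1)%:E)).
  by move=> n; apply/measurable_EFinP; exact: mc.
move=> [w s] _ /=; apply: cvg_EFin; first exact: nearW.
exact: (cvg_comp _ _ (cvgc s) (cZ w s)).
Unshelve. all: by end_near. Qed.

End JointMeasurability.
Section WeightedPathIntegral.
Context {d : measure_display} {T : measurableType d} {R : realType}.
Variable P : probability T R.
Local Notation mu := (@lebesgue_measure R).

Lemma EFin_Rintegral {d' : measure_display} {S : measurableType d'}
    (m : {measure set S -> \bar R}) (D : set S) (f : S -> R) :
  measurable D -> m.-integrable D (EFin \o f) ->
  (\int[m]_(x in D) (f x)%:E = (\int[m]_(x in D) f x)%:E)%E.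
Proof. by move=> mD fi; rewrite /Rintegral fineK//; exact: integrable_fin_num. Qed.

(** The bound on the weighted integral is part of the conclusion so that the
    lemma can be applied again with [U] built from path integrals. *)
Lemma fubini_path_integral (Z : R -> T -> R) (U : T -> R) (k : R -> R) (t M : R) :
  (forall s, measurable_fun setT (Z s)) -> (forall w, continuous (Z ^~ w)) ->
  measurable_fun setT U -> continuous k -> (forall s, 0 <= k s) ->
  (forall s, 0 <= s <= t -> (\int[P]_w `|U w * Z s w|%:E <= M%:E)%E) ->
  let J w := \int[mu]_(s in `[0, t]) (k s * Z s w) in
  [/\ P.-integrable setT (fun w => (U w * J w)%:E),
    (\int[P]_w `|U w * J w|%:E <= (\int[mu]_(s in `[0, t]) k s * M)%:E)%E &
    \int[P]_w (U w * J w) =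
    \int[mu]_(s in `[0, t]) (k s * \int[P]_w (U w * Z s w))].
Proof.
move=> mZ cZ mU ck k0 UZM J.
pose D : set R := [set` `[0, t]].
have mD : measurable D by exact: measurable_itv.
pose f (p : T * R) : \bar R := (U p.1 * (k p.2 * Z p.2 p.1) * \1_D p.2)%:E.
have mf : measurable_fun setT f.
  apply/measurable_EFinP; apply: measurable_funM.
    apply: measurable_funM; first exact: measurableT_comp mU measurable_fst.
    apply: measurable_funM.
      apply: measurableT_comp measurable_snd.
      exact: continuous_measurable_fun.
    exact: measurable_fun_continuous_path.
  by apply: measurableT_comp measurable_snd; exact: measurable_indic.
have ckZ w : continuous (fun s => k s * Z s w).
  by move=> s; apply: cvgM; [exact: ck|exact: cZ].
have FE w : (\int[mu]_s f (w, s) = (U w * J w)%:E)%E.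
  transitivity (\int[mu]_(s in D) (U w * (k s * Z s w))%:E)%E.
    rewrite [RHS]integral_mkcond; apply: eq_integral => s _.
    by rewrite /f/= patchE indicE; case: ifPn => _; rewrite ?mulr1 ?mulr0.
  rewrite EFin_Rintegral//; last first.
    apply: continuous_itv_integrable => s.
    by apply: cvgM; [exact: cvg_cst|exact: ckZ].
  by rewrite RintegralZl//; exact: continuous_itv_integrable.
have mUZ s : measurable_fun setT (fun w => U w * Z s w).
  exact: measurable_funM.
have absE s : (\int[P]_w `|f (w, s)| =
    (k s * \1_D s)%:E * \int[P]_w `|U w * Z s w|%:E)%E.
  rewrite -ge0_integralZl//; last 2 first.
  - by apply/measurable_EFinP; apply: measurableT_comp => //.
  - by rewrite lee_fin mulr_ge0// indicE ler0n.
  apply: eq_integral => w _; rewrite /f/= -EFinM; congr EFin.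
  rewrite !normrM (ger0_norm (k0 _)) (@ger0_norm _ (\1_D s)) ?indicE//.
  ring.
have kD : mu.-integrable D (EFin \o k) by exact: continuous_itv_integrable.
have absle : (\int[mu]_s \int[P]_w `|f (w, s)| <=
    (\int[mu]_(s in D) k s * M)%:E)%E.
  rewrite EFinM muleC -EFin_Rintegral// -integralZl//.
  rewrite [leRHS]integral_mkcond.
  apply: ge0_le_integral => //.
  - by move=> s _; exact: integral_ge0.
  - apply: (@measurable_fun_fubini_tonelli_G _ _ _ _ _ P (abse \o f)).
      exact: measurableT_comp.
    by move=> x; exact: abse_ge0.
  - apply/(measurable_restrictT _ _).1 => //; apply: measurable_funeM.
    by apply/measurable_EFinP; apply: measurable_funTS; exact: continuous_measurable_fun.
  - move=> s _; rewrite absE patchE indicE; case: ifPn => sD.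
      rewrite mulr1 muleC; apply: lee_wpmul2r; first by rewrite lee_fin.
      by apply: UZM; move: sD; rewrite inE /D/= in_itv.
    by rewrite mulr0 mul0e.
have fint : (P \x mu)%E.-integrable setT f.
  apply/integrable21ltyP => //; apply: le_lt_trans absle _; exact: ltry.
split.
- have := integrable_fubini_F fint; congr (_.-integrable _ _).
  by apply/funext => w; exact: FE.
- apply: le_trans absle.
  have -> : (\int[mu]_s \int[P]_w `|f (w, s)| =
      \int[P]_w \int[mu]_s `|f (w, s)|)%E.
    have := @fubini_tonelli _ _ _ _ R P mu (abse \o f).
    move=> /(_ (measurableT_comp (@abse_measurable R setT) mf)).
    move=> /(_ (fun x => abse_ge0 (f x))) e.
    exact: esym e.
  apply: ge0_le_integral => //.
  - apply/measurable_EFinP; apply: measurableT_comp => //.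
    apply/measurable_EFinP; have := measurable_fubini_F fint.
    by congr (measurable_fun _ _); apply/funext => w; exact: FE.
  - apply: (@measurable_fun_fubini_tonelli_F _ _ _ _ _ mu (abse \o f)).
      exact: measurableT_comp.
    by move=> x; exact: abse_ge0.
  - move=> w _; rewrite -abse_EFin -FE.
    apply: le_abse_integral => //.
    by apply: measurableT_comp => //; exact: measurable_pair1.
- rewrite /Rintegral; congr fine.
  under [LHS]eq_integral do rewrite -FE.
  rewrite (Fubini fint) [RHS]integral_mkcond; apply: eq_integral => s _.
  rewrite patchE; case: ifPn => sD; last first.
    rewrite (eq_integral (cst 0%E)) ?integral0// => w _.
    by rewrite /f/= indicE (negbTE sD) mulr0.
  have UZi : P.-integrable setT (EFin \o (fun w => U w * Z s w)).
    apply/integrableP; split; first exact/measurable_EFinP.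
    apply: le_lt_trans (UZM s _) (ltry _).
    by move: sD; rewrite inE /D/= in_itv.
  rewrite -RintegralZl// -EFin_Rintegral//.
    apply: eq_integral => w _; rewrite /f/= indicE sD mulr1; congr EFin; ring.
  have := integrableZl measurableT (k s) UZi.
  by congr (_.-integrable _ _).
Qed.

End WeightedPathIntegral.
(** * Second moments *)

Section SquareIntegrable.
Context {d : measure_display} {T : measurableType d} {R : realType}.
Variable P : probability T R.

Lemma integral_normM_le (X Y : T -> R) :
  measurable_fun setT X -> measurable_fun setT Y ->
  (\int[P]_w `|X w * Y w|%:E <=
   \int[P]_w (X w * X w)%:E + \int[P]_w (Y w * Y w)%:E)%E.
Proof.
move=> mX mY; rewrite -ge0_integralD//; last 4 first.
- by move=> w _; rewrite lee_fin -expr2 sqr_ge0.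
- by apply/measurable_EFinP; exact: measurable_funM.
- by move=> w _; rewrite lee_fin -expr2 sqr_ge0.
- by apply/measurable_EFinP; exact: measurable_funM.
apply: ge0_le_integral => //.
- apply/measurable_EFinP; apply: measurableT_comp => //.
  exact: measurable_funM.
- by apply: emeasurable_funD; apply/measurable_EFinP; exact: measurable_funM.
- move=> w _; rewrite -EFinD lee_fin ler_norml; apply/andP; split.
    by have := sqr_ge0 (X w + Y w); nra.
  by have := sqr_ge0 (X w - Y w); nra.
Qed.

Lemma integrable_mul (X Y : T -> R) :
  measurable_fun setT X -> measurable_fun setT Y ->
  (\int[P]_w (X w * X w)%:E < +oo)%E -> (\int[P]_w (Y w * Y w)%:E < +oo)%E ->
  P.-integrable setT (fun w => (X w * Y w)%:E).
Proof.
move=> mX mY iX iY; apply/integrableP; split.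
  by apply/measurable_EFinP; exact: measurable_funM.
by apply: le_lt_trans (integral_normM_le mX mY) _; exact: lte_add_pinfty.
Qed.

Lemma integral_cst1_sqr : (\int[P]_w (cst 1 w * cst 1 w)%:E = 1)%E.
Proof.
under eq_integral do rewrite /= mulr1.
by rewrite integral_cst// mul1e; exact: probability_setT.
Qed.

Lemma integrable_of_sqr (X : T -> R) : measurable_fun setT X ->
  (\int[P]_w (X w * X w)%:E < +oo)%E -> P.-integrable setT (EFin \o X).
Proof.
move=> mX iX; have := @integrable_mul (cst 1) X (measurable_cst _) mX.
rewrite integral_cst1_sqr => /(_ (ltry _) iX).
by under eq_fun do rewrite mul1r.
Qed.

Lemma integral_shift (m : R) (X : T -> R) :
  P.-integrable setT (EFin \o X) -> \int[P]_w X w = 0 ->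
  (\int[P]_w (m + X w)%:E = m%:E)%E.
Proof.
move=> iX EX; under eq_integral do rewrite EFinD.
rewrite integralD//; last exact: finite_measure_integrable_cst.
rewrite (EFin_Rintegral measurableT iX) EX adde0 integral_cst//.
by rewrite -[RHS]mule1; congr (_ * _)%E; exact: probability_setT.
Qed.

Lemma integral_shift_mul (m n : R) (X Y : T -> R) :
  P.-integrable setT (EFin \o X) -> \int[P]_w X w = 0 ->
  P.-integrable setT (EFin \o Y) -> \int[P]_w Y w = 0 ->
  P.-integrable setT (fun w => (X w * Y w)%:E) ->
  (\int[P]_w ((m + X w) * (n + Y w))%:E =
   (m * n + \int[P]_w (X w * Y w))%:E)%E.
Proof.
move=> iX EX iY EY iXY.
have iZl k (V : T -> R) : P.-integrable setT (EFin \o V) ->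
    P.-integrable setT (EFin \o (fun w => k * V w)).
  by move=> i; have := integrableZl measurableT k i; congr (_.-integrable _ _).
have i1 : P.-integrable setT (EFin \o (fun w => n * X w + X w * Y w)).
  have := integrableD measurableT (iZl n X iX) iXY.
  by congr (_.-integrable _ _).
have i2 : P.-integrable setT
    (EFin \o (fun w => m * Y w + (n * X w + X w * Y w))).
  have := integrableD measurableT (iZl m Y iY) i1.
  by congr (_.-integrable _ _).
transitivity (\int[P]_w (m * n + (m * Y w + (n * X w + X w * Y w)))%:E)%E.
  by apply: eq_integral => w _; congr EFin; ring.
under eq_integral do rewrite EFinD.
rewrite integralD//; last exact: finite_measure_integrable_cst.
rewrite (EFin_Rintegral measurableT i2).
rewrite (RintegralD measurableT (iZl m Y iY) i1).
rewrite (RintegralD measurableT (iZl n X iX) iXY).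
rewrite (RintegralZl m measurableT iY) (RintegralZl n measurableT iX).
rewrite EX EY !mulr0 !add0r integral_cst// EFinD.
congr (_ + _)%E.
by rewrite -[RHS]mule1; congr (_ * _)%E; exact: probability_setT.
Qed.

End SquareIntegrable.

(** * The covariance of the centered solution *)

Section SecondOrderProcess.
Context {d : measure_display} {T : measurableType d} {R : realType}.
Variable P : probability T R.
Variables (Z : R -> T -> R) (h th s2 : R).
Hypothesis h_gt0 : 0 < h.
Hypothesis th_gt0 : 0 < th.
Hypothesis mZ : forall s, measurable_fun setT (Z s).
Hypothesis cZ : forall w, continuous (Z ^~ w).
Hypothesis Z_mean : forall s, 0 <= s -> (\int[P]_w (Z s w)%:E = 0)%E.
Hypothesis Z_cov : forall s u, 0 <= s -> 0 <= u ->
  (\int[P]_w (Z s w * Z u w)%:E = (s2 * fbm_cov h s u)%:E)%E.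
Local Notation mu := (@lebesgue_measure R).
Implicit Types (s t u N M : R) (w : T).

Let phi_max s N : 0 <= s <= N -> `|s| `^ h <= `|N| `^ h.
Proof.
move=> /andP[s0 sN]; apply: ge0_ler_powR; rewrite ?nnegrE//; first exact: ltW.
by rewrite !ger0_norm// (le_trans s0).
Qed.

Let Z_sqr s N : 0 <= s <= N ->
  (\int[P]_w (Z s w * Z s w)%:E <= (`|s2| * `|N| `^ h)%:E)%E.
Proof.
move=> sN; have /andP[s0 _] := sN.
rewrite Z_cov// lee_fin /fbm_cov subrr normr0 powR0 ?gt_eqF// subr0.
apply: (@le_trans _ _ (`|s2| * `|s| `^ h)); last first.
  by rewrite ler_wpM2l// phi_max.
have -> : 2^-1 * (`|s| `^ h + `|s| `^ h) = `|s| `^ h by lra.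
by rewrite ler_wpM2r ?powR_ge0// ler_norm.
Qed.

Let mZ2 s u : measurable_fun setT (fun w => Z s w * Z u w).
Proof. exact: measurable_funM. Qed.

Let Z_abs s N : 0 <= s <= N ->
  (\int[P]_w `|cst 1 w * Z s w|%:E <= (1 + `|s2| * `|N| `^ h)%:E)%E.
Proof.
move=> sN; apply: le_trans (integral_normM_le _ _ _) _ => //.
by rewrite integral_cst1_sqr EFinD leeD2l// Z_sqr.
Qed.

Let Z_abs2 s u N : 0 <= s <= N -> 0 <= u <= N ->
  (\int[P]_w `|Z u w * Z s w|%:E <=
   (`|s2| * `|N| `^ h + `|s2| * `|N| `^ h)%:E)%E.
Proof.
move=> sN uN; apply: le_trans (integral_normM_le _ _ _) _ => //.
by rewrite EFinD leeD// Z_sqr.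
Qed.

Let k t (s : R) : R := expR (th * (s - t)).

Let ck t : continuous (k t).
Proof.
move=> s; apply: (@continuous_comp _ _ _ (fun s => th * (s - t)) expR).
  by apply: cvgM; [exact: cvg_cst|apply: cvgB; [exact: cvg_id|exact: cvg_cst]].
exact: continuous_expR.
Qed.

Let k0 t s : 0 <= k t s. Proof. exact: expR_ge0. Qed.

Definition noise_convolution t w : R :=
  \int[mu]_(s in `[0, t]) (expR (th * (s - t)) * Z s w).
Local Notation J := noise_convolution.

Definition centered_solution t w : R := Z t w - th * J t w.
Local Notation Y := centered_solution.

Let J_mean t : 0 <= t ->
  P.-integrable setT (EFin \o J t) /\ \int[P]_w J t w = 0.
Proof.
move=> t0.
have [] := @fubini_path_integral _ _ _ P Z (cst 1) (k t) t _ mZ cZ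
  (measurable_cst _) (@ck t) (@k0 t) (fun s sN => Z_abs sN).
move=> iJ _; rewrite (_ : (fun w => _) = EFin \o J t) in iJ; last first.
  by apply/funext => w /=; rewrite mul1r.
under eq_Rintegral do rewrite mul1r.
rewrite -/(J t) => ->; split => //.
transitivity (\int[mu]_(s in `[0, t]) (0 : R)); last first.
  by rewrite Rintegral_cst// mul0r.
apply: eq_Rintegral => s.
rewrite inE/= in_itv/= => /andP[s0 _].
under eq_Rintegral do rewrite mul1r.
by rewrite /Rintegral Z_mean// mulr0.
Qed.

Let ZJ t N : 0 <= t <= N -> exists M, forall u, 0 <= u <= N ->
  [/\ P.-integrable setT (fun w => (Z u w * J t w)%:E),
   (\int[P]_w `|Z u w * J t w|%:E <= M%:E)%E &
   \int[P]_w (Z u w * J t w) =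
   s2 * \int[mu]_(s in `[0, t]) (expR (th * (s - t)) * fbm_cov h s u)].
Proof.
move=> /andP[t0 tN].
have b s : 0 <= s <= t -> 0 <= s <= N.
  by move=> /andP[-> st]; exact: le_trans tN.
exists (\int[mu]_(s in `[0, t]) k t s * (`|s2| * `|N| `^ h + `|s2| * `|N| `^ h)).
move=> u uN.
have [iJ leJ EJ] := @fubini_path_integral _ _ _ P Z (Z u) (k t) t _ mZ cZ
  (mZ u) (@ck t) (@k0 t) (fun s st => Z_abs2 (b s st) uN).
split; [exact: iJ|exact: leJ|].
rewrite EJ -RintegralZl//; last first.
  exact/continuous_itv_integrable/continuous_weight_fbm_cov.
apply: eq_Rintegral => s; rewrite inE/= in_itv/= => /andP[s0 _].
have /andP[u0 _] := uN.
rewrite /k mulrCA; congr (_ * _).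
under eq_Rintegral do rewrite mulrC.
by rewrite /Rintegral Z_cov.
Qed.

Let mJ t : 0 <= t -> measurable_fun setT (J t).
Proof.
by move=> t0; apply/measurable_EFinP; exact: measurable_int (J_mean t0).1.
Qed.

Let mY t : 0 <= t -> measurable_fun setT (Y t).
Proof.
move=> t0; apply: measurable_funB => //; apply: measurable_funM => //.
exact: mJ.
Qed.

Let Z_sqr_lty s : 0 <= s -> (\int[P]_w (Z s w * Z s w)%:E < +oo)%E.
Proof. by move=> s0; rewrite Z_cov// ltry. Qed.

Let iZ s : 0 <= s -> P.-integrable setT (EFin \o Z s).
Proof. by move=> s0; apply: integrable_of_sqr => //; exact: Z_sqr_lty. Qed.

Let iZZ s u : 0 <= s -> 0 <= u -> P.-integrable setT (fun w => (Z s w * Z u w)%:E).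
Proof. by move=> s0 u0; apply: integrable_mul => //; exact: Z_sqr_lty. Qed.

Lemma centered_solution_mean t : 0 <= t ->
  P.-integrable setT (EFin \o Y t) /\ \int[P]_w Y t w = 0.
Proof.
move=> t0; have [iJ EJ] := J_mean t0.
have iJ' : P.-integrable setT (EFin \o (fun w => th * J t w)).
  have := integrableZl measurableT th iJ.
  by congr (_.-integrable _ _).
split.
  by have := integrableB measurableT (iZ t0) iJ'; congr (_.-integrable _ _).
rewrite /Y RintegralB//; last exact: iZ.
by rewrite RintegralZl// EJ mulr0 subr0 /Rintegral Z_mean.
Qed.

(** The bound [M] must not depend on [u], which is a variable of integration when
    Fubini's theorem is applied with [U = Y t]. *)
Let YZ t N : 0 <= t <= N -> exists M, forall u, 0 <= u <= N ->
  [/\ P.-integrable setT (fun w => (Y t w * Z u w)%:E),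
   (\int[P]_w `|Y t w * Z u w|%:E <= M%:E)%E &
   \int[P]_w (Y t w * Z u w) = s2 * solution_noise_cov h th t u].
Proof.
move=> tN; have /andP[t0 _] := tN.
have [M ZJM] := ZJ tN.
exists (`|s2| * `|N| `^ h + `|s2| * `|N| `^ h + th * M) => u uN.
have /andP[u0 _] := uN; have [iZJ leZJ EZJ] := ZJM u uN.
have iJ : P.-integrable setT (fun w => (th * (Z u w * J t w))%:E).
  have := integrableZl measurableT th iZJ.
  by congr (_.-integrable _ _).
have YE w : Y t w * Z u w = Z t w * Z u w - th * (Z u w * J t w).
  by rewrite /Y; ring.
have ZZb := Z_abs2 uN tN.
split.
- under eq_fun do rewrite YE.
  by have := integrableB measurableT (iZZ t0 u0) iJ; congr (_.-integrable _ _).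
- apply: (@le_trans _ _
     (\int[P]_w (`|Z t w * Z u w|%:E + th%:E * `|Z u w * J t w|%:E))%E).
    have mZJ : measurable_fun setT (fun w => Z u w * J t w).
      by apply: measurable_funM => //; exact: mJ.
    apply: ge0_le_integral => //.
    + apply/measurable_EFinP; apply: measurableT_comp => //.
      by apply: measurable_funM => //; exact: mY.
    + apply: emeasurable_funD.
        by apply/measurable_EFinP; apply: measurableT_comp.
      by apply: measurable_funeM; apply/measurable_EFinP; apply: measurableT_comp.
    + move=> w _; rewrite -EFinM -EFinD lee_fin YE (le_trans (ler_normB _ _))//.
      by rewrite lerD2l normrM (gtr0_norm th_gt0).
  have mZJ : measurable_fun setT (fun w => `|Z u w * J t w|%:E).
    apply/measurable_EFinP; apply: measurableT_comp => //.
    by apply: measurable_funM => //; exact: mJ.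
  rewrite ge0_integralD//; last 3 first.
  + by apply/measurable_EFinP; apply: measurableT_comp.
  + by move=> w _; rewrite -EFinM lee_fin mulr_ge0// ltW.
  + exact: measurable_funeM.
  rewrite ge0_integralZl//; last by rewrite lee_fin ltW.
  rewrite EFinD leeD// EFinM; apply: lee_wpmul2l => //.
  by rewrite lee_fin ltW.
- under eq_Rintegral do rewrite YE.
  rewrite RintegralB//; last exact: iZZ.
  rewrite RintegralZl// EZJ /solution_noise_cov mulrBr; congr (_ - _).
    by rewrite /Rintegral Z_cov.
  by rewrite mulrCA.
Qed.

Lemma centered_solution_cov t t' : 0 <= t -> 0 <= t' ->
  P.-integrable setT (fun w => (Y t w * Y t' w)%:E) /\
  \int[P]_w (Y t w * Y t' w) = s2 *
    (stationary_cov h th (t' - t) - expR (- th * t) * stationary_cov h th t'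
     - expR (- th * t') * stationary_cov h th t
     + expR (- th * t) * expR (- th * t') * stationary_cov h th 0).
Proof.
move=> t0 t'0.
pose N := Num.max t t'.
have tN : 0 <= t <= N by rewrite t0 le_max lexx.
have t'N : 0 <= t' <= N by rewrite t'0 le_max lexx orbT.
have bN u : 0 <= u <= t' -> 0 <= u <= N.
  by move=> /andP[-> ut]; rewrite (le_trans ut)// le_max lexx orbT.
have [M YZM] := YZ tN.
have YZle u : 0 <= u <= t' -> (\int[P]_w `|Y t w * Z u w|%:E <= M%:E)%E.
  by move=> /bN/YZM[].
have [iJ _ EJ] := @fubini_path_integral _ _ _ P Z (Y t) (k t') t' M mZ cZ
  (mY t0) (@ck t') (@k0 t') YZle.
have [iYZ _ EYZ] := YZM t' t'N.
have YE w : Y t w * Y t' w = Y t w * Z t' w - th * (Y t w * J t' w).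
  by rewrite {2}/Y; ring.
have iJ' : P.-integrable setT (fun w => (th * (Y t w * J t' w))%:E).
  have := integrableZl measurableT th iJ.
  by congr (_.-integrable _ _).
split.
  under eq_fun do rewrite YE.
  by have := integrableB measurableT iYZ iJ'; congr (_.-integrable _ _).
under eq_Rintegral do rewrite YE.
rewrite RintegralB// RintegralZl// EJ EYZ -transient_cov// [RHS]mulrBr.
congr (_ - _); rewrite [RHS]mulrCA; congr (_ * _).
rewrite -RintegralZl//; last first.
  exact/continuous_itv_integrable/continuous_weight_solution_noise_cov.
apply: eq_Rintegral => u; rewrite inE/= in_itv/= => /bN/YZM[_ _ ->].
by rewrite /k mulrCA.
Qed.

End SecondOrderProcess.
(** * From almost every path to every path *)

Section ModifiedNoise.
Context {d : measure_display} {T : measurableType d} {R : realType}.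
Variable P : probability T R.
Local Notation mu := (@lebesgue_measure R).

Lemma continuous_max0 : continuous (fun s : R => Num.max 0 s).
Proof.
by move=> s; apply: (@continuous_max R R (cst 0) id); [exact: cvg_cst|exact: cvg_id].
Qed.

(** Freezing a path at its value at time [0] extends it continuously to negative
    times. *)
Lemma continuous_clamp (f : R -> R) :
  {within `[0, +oo[, continuous f} -> continuous (fun s : R => f (Num.max 0 s)).
Proof.
move=> /subspace_continuousP cf s.
have m0 (u : R) : `[0, +oo[%classic (Num.max 0 u).
  by rewrite /= in_itv/= andbT le_max lexx.
have H : Num.max 0 u @[u --> s] --> within `[0, +oo[%classic (nbhs (Num.max 0 s)).
  move=> B wB; have near_s : \near s, `[0, +oo[%classic (Num.max 0 s) -> B (Num.max 0 s).
    exact: (continuous_max0 wB).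
  have : \near s, B (Num.max 0 s) by apply: filterS near_s => u; apply; exact: m0.
  exact.
exact: (cvg_comp _ _ H (cf _ (m0 s))).
Qed.

Lemma integral_eq_off_null (f g : T -> R) (N : set T) :
  measurable_fun setT f -> measurable_fun setT g ->
  measurable N -> P N = 0%E -> (forall w, ~ N w -> f w = g w) ->
  (\int[P]_w (f w)%:E = \int[P]_w (g w)%:E)%E.
Proof.
move=> mf mg mN N0 fg; apply: ae_eq_integral => //.
- exact/measurable_EFinP.
- exact/measurable_EFinP.
- exists N; split => // w /= nfg; apply: contrapT => nN; apply: nfg => _.
  by rewrite fg.
Qed.

End ModifiedNoise.

(** * The autocovariance of the solution *)

Section LangevinCovariance.
Context {d : measure_display} {T : measurableType d} {R : realType}.
Variable P : probability T R.
Variables (H sigma th x0 : R) (W x : R -> {RV P >-> R}).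
Hypothesis H_gt0 : 0 < H.
Hypothesis th_gt0 : 0 < th.
Hypothesis W_fbm : fractional_brownian_motion H W.
Hypothesis x_sol : langevin_solution (- th) sigma x0 W x.
Implicit Types (s t u : R) (w : T).
Local Notation mu := (@lebesgue_measure R).
Local Notation h := (2 * H).

Let h_gt0 : 0 < h. Proof. by rewrite mulr_gt0. Qed.

(** The noise is put to [0] on a null set containing the exceptional paths and
    frozen at negative times: all its paths are then continuous on the line. *)
Definition modified_noise (N : set T) s w : R :=
  sigma * W (Num.max 0 s) w * \1_(~` N) w.

Lemma autocovariance_langevin t t' : 0 <= t -> 0 <= t' ->
  ('E_P[x t \* x t'] - 'E_P[x t] * 'E_P[x t'])%E = (sigma ^+ 2 *
    (stationary_cov h th (t' - t) - expR (- th * t) * stationary_cov h th t'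
     - expR (- th * t') * stationary_cov h th t
     + expR (- th * t) * expR (- th * t') * stationary_cov h th 0))%:E.
Proof.
move=> t0 t'0.
have [N [mN N0 NQ]] := x_sol.
have good w : ~ N w -> {within `[0, +oo[, continuous (fun t : R => x t w)} /\
     forall t : R, 0 <= t ->
       x t w = x0 + - th * (\int[mu]_(s in `[0, t]) x s w) + sigma * W t w.
  by move=> nN; apply: contrapT => nQ; apply: nN; exact: NQ.
pose Z := modified_noise N.
have mW s : measurable_fun setT (W s : T -> R) by exact: measurable_funPT.
have mx s : measurable_fun setT (x s : T -> R) by exact: measurable_funPT.
have mZ s : measurable_fun setT (Z s).
  apply: measurable_funM; first exact: measurable_funM.
  by apply: measurable_indic; exact: measurableC.
have ZE s w : 0 <= s -> ~ N w -> Z s w = sigma * W s w.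
  move=> s0 nN; rewrite /Z /modified_noise max_r// indicE mem_set//.
  by rewrite mulr1.
have cy w : ~ N w -> continuous (fun s : R => x (Num.max 0 s) w).
  by move=> /good[cx _]; exact: (@continuous_clamp _ (fun t => x t w)).
have yint w t1 : \int[mu]_(s in `[0, t1]) x s w =
    \int[mu]_(s in `[0, t1]) x (Num.max 0 s) w.
  apply: eq_Rintegral => s; rewrite inE/= in_itv/= => /andP[s0 _].
  by rewrite max_r.
have cZ w : continuous (Z ^~ w).
  have [Nw|nNw] := pselect (N w).
    have -> : Z ^~ w = cst 0; last by move=> s; exact: cvg_cst.
    apply/funext => s; rewrite /Z /modified_noise indicE memNset ?mulr0//.
  (* The equation expresses the noise through the solution, which is where the
     continuity of the noise comes from. *)
  have -> : Z ^~ w = fun s => x (Num.max 0 s) w - x0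
      + th * primitive (fun s => x (Num.max 0 s) w) (Num.max 0 s).
    apply/funext => s; rewrite /Z /modified_noise indicE mem_set// mulr1.
    have m0 : 0 <= Num.max 0 s by rewrite le_max lexx.
    have [_ /(_ _ m0) e] := good w nNw.
    rewrite {1}e yint /primitive m0; ring.
  move=> s; apply: cvgD.
    by apply: cvgB; [exact: cy|exact: cvg_cst].
  apply: cvgM; first exact: cvg_cst.
  apply: (@continuous_comp _ _ _ (fun s : R => Num.max 0 s)
    (primitive (fun s => x (Num.max 0 s) w))); first exact: continuous_max0.
  exact/continuous_primitive/cy.
have [_ W_mean W_cov] := W_fbm.
have W_sqr s : 0 <= s -> (\int[P]_w (W s w * W s w)%:E < +oo)%E.
  by move=> s0; have := W_cov s s s0 s0; rewrite unlock => ->; exact: ltry.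
have Z_mean s : 0 <= s -> (\int[P]_w (Z s w)%:E = 0)%E.
  move=> s0; rewrite (@integral_eq_off_null _ _ _ P _ (fun w => sigma * W s w) N)//.
  - under eq_integral do rewrite EFinM.
    rewrite integralZl//; last by apply: integrable_of_sqr => //; exact: W_sqr.
    by have := W_mean s s0; rewrite unlock => ->; rewrite mule0.
  - exact: measurable_funM.
  - by move=> w nN; exact: ZE.
have Z_cov s u : 0 <= s -> 0 <= u ->
    (\int[P]_w (Z s w * Z u w)%:E = (sigma ^+ 2 * fbm_cov h s u)%:E)%E.
  move=> s0 u0.
  rewrite (@integral_eq_off_null _ _ _ P _ (fun w => sigma ^+ 2 * (W s w * W u w)) N)//.
  - under eq_integral do rewrite EFinM.
    rewrite integralZl//; last by apply: integrable_mul => //; exact: W_sqr.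
    have := W_cov s u s0 u0; rewrite unlock => ->; rewrite -EFinM.
    by rewrite /fbm_cov (ger0_norm s0) (ger0_norm u0) distrC.
  - exact: measurable_funM.
  - by apply: measurable_funM => //; exact: measurable_funM.
  - by move=> w nN; rewrite !ZE//; ring.
pose Y := centered_solution Z th.
pose m t := expR (- th * t) * x0.
have xE s w : 0 <= s -> ~ N w -> x s w = m s + Y s w.
  move=> s0 nN; have [_ e] := good w nN.
  have := @variation_of_constants _ (fun s => x (Num.max 0 s) w) (Z ^~ w) th x0
    th_gt0 (cy w nN) (cZ w) _ s s0.
  rewrite max_r// => ->; first by rewrite /m /Y /centered_solution addrA.
  by move=> u u0; rewrite max_r// -yint ZE// -mulNr; exact: e.
have mY s : 0 <= s -> P.-integrable setT (EFin \o Y s) /\ \int[P]_w Y s w = 0.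
  exact: (centered_solution_mean th h_gt0 mZ cZ Z_mean Z_cov).
have [iYY EYY] := centered_solution_cov h_gt0 th_gt0 mZ cZ Z_mean Z_cov t0 t'0.
have Ex s : 0 <= s -> ('E_P[x s] = (m s)%:E)%E.
  move=> s0; have [iY EY] := mY s s0; rewrite unlock.
  have mYs : measurable_fun setT (Y s).
    by apply/measurable_EFinP; exact: measurable_int iY.
  rewrite (@integral_eq_off_null _ _ _ P _ (fun w => m s + Y s w) N)//; last 2 first.
  - exact: measurable_funD.
  - by move=> w nN; exact: xE.
  exact: integral_shift.
have [iYt EYt] := mY t t0; have [iYt' EYt'] := mY t' t'0.
have mYt : measurable_fun setT (Y t).
  by apply/measurable_EFinP; exact: measurable_int iYt.
have mYt' : measurable_fun setT (Y t').
  by apply/measurable_EFinP; exact: measurable_int iYt'.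
have -> : ('E_P[x t \* x t'] = (m t * m t' + \int[P]_w (Y t w * Y t' w))%:E)%E.
  rewrite unlock (@integral_eq_off_null _ _ _ P _
    (fun w => (m t + Y t w) * (m t' + Y t' w)) N) => [|||||w nN] //.
  - exact: integral_shift_mul.
  - by apply: measurable_funM; exact: measurable_funD.
  - by rewrite /= (xE _ _ t0 nN) (xE _ _ t'0 nN).
by rewrite !Ex// -EFinM -EFinB EYY addrAC subrr add0r.
Qed.

End LangevinCovariance.

Theorem theorem3p2 (R : realType) (d : measure_display) (T : measurableType d)
    (P : probability T R)
    (lambdas : R) (A : R -> R)
    (A_cont : {within `]-oo, lambdas], continuous A})
    (A_neg : forall l : R, l < lambdas -> A l < 0)
    (A_zero : A lambdas = 0)
    (H tau sigma lambda x0 : R)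
    (H_gt0 : 0 < H) (H_lt1 : H < 1) (tau_ge0 : 0 <= tau)
    (lambda_lt : lambda < lambdas)
    (W x : R -> {RV P >-> R})
    (W_fbm : fractional_brownian_motion H W)
    (x_sol : langevin_solution (A lambda) sigma x0 W x) :
  autocovariance x tau t @[t --> +oo] -->
    (sigma ^+ 2 / 2 * H * `|A lambda| `^ (- (2 * H)) *
      (expR (A lambda * tau) * Gamma (2 * H)
       + expR (- A lambda * tau) * upper_Gamma (2 * H) (`|A lambda| * tau)
       - expR (A lambda * tau) *
         \int[lebesgue_measure]_(w in `[0%R, (`|A lambda| * tau)%R])
           (expR w * w `^ (2 * H - 1))))%:E.
Proof.
have th_gt0 : 0 < - A lambda by rewrite oppr_gt0 A_neg.
have h_gt0 : 0 < 2 * H by rewrite mulr_gt0.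
have h_lt2 : 2 * H < 2 by lra.
rewrite (ltr0_norm (A_neg _ lambda_lt)).
move: x_sol; set th := - A lambda.
have -> : A lambda = - th by rewrite /th opprK.
move=> x_sol'.
have -> : sigma ^+ 2 / 2 * H * th `^ (- (2 * H)) *
      (expR (- th * tau) * Gamma (2 * H)
       + expR (th * tau) * upper_Gamma (2 * H) (th * tau)
       - expR (- th * tau) *
         \int[lebesgue_measure]_(w in `[0%R, (th * tau)%R])
           (expR w * w `^ (2 * H - 1)))
    = sigma ^+ 2 * stationary_cov (2 * H) th tau.
  by rewrite stationary_covE//; field.
have cvgC : (sigma ^+ 2 *
    (stationary_cov (2 * H) th ((t + tau) - t)
     - expR (- th * t) * stationary_cov (2 * H) th (t + tau)
     - expR (- th * (t + tau)) * stationary_cov (2 * H) th t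
     + expR (- th * t) * expR (- th * (t + tau)) * stationary_cov (2 * H) th 0))%:E
    @[t --> +oo] --> (sigma ^+ 2 * stationary_cov (2 * H) th tau)%:E.
  apply: cvg_EFin; first exact: nearW.
  by apply: cvgM; [exact: cvg_cst|exact: cvg_transient_cov].
apply: cvg_trans cvgC; apply: near_eq_cvg; near=> t.
have t0 : 0 <= t by near: t; exact: nbhs_pinfty_ge.
rewrite /autocovariance.
by rewrite (autocovariance_langevin H_gt0 th_gt0 W_fbm x_sol')// addr_ge0.
Unshelve. all: by end_near. Qed.
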